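(* Let $H$ be a stringent skew hyperfield, and let $M$ be a left $H$-matroid on ground set $E$. If $V$ is a vector of $M$ and $U$ is a covector of $M$, then $V\perp U$.
   Context: A skew hyperfield $H$ has a multiplication making $H^\star=H\setminus\{0\}$ a group (with $0\cdot x=x\cdot 0=0$) and a commutative, associative hyperaddition $\boxplus:H\times H\to 2^H\setminus\{\emptyset\}$ with $x\boxplus 0=\{x\}$, a unique $-x$ with $0\in x\boxplus(-x)$, $x\in y\boxplus z \iff z\in(-y)\boxplus x$, and two-sided distributivity. For sets, $A\boxplus B$ is the union of $a\boxplus b$ over $a\in A,b\in B$. $H$ is stringent if $a\boxplus b$ is a singleton whenever $a\neq -b$. For $X\in H^E$, $\underline{X}=\{e: X_e\neq 0\}$ is its support. A left $H$-matroid on finite $E$ is a set $\mathcal{C}\subseteq H^E$ (the circuits) with: (C0) $0\notin\mathcal C$; (C1) $\alpha X\in\mathcal C$ for $X\in\mathcal C,\alpha\in H^\star$; (C2) if $X,Y\in\mathcal C$ and $\underline X\subseteq\underline Y$ then $Y=\alpha X$ for some $\alpha\in H^\star$; (C3) if $X,Y\in\mathcal C$ form a modular pair (no two distinct $X',Y'\in\mathcal C$ have $\underline{X'}\cup\underline{Y'}$ a proper subset of $\underline X\cup\underline Y$) and $X_e=-Y_e\neq 0$, then some $Z\in\mathcal C$ has $Z_e=0$ and $Z_f\in X_f\boxplus Y_f$ for all $f$. For $X,Y\in H^E$ with $E=\{e_1,\dots,e_n\}$, $X\perp Y$ means $0\in X_{e_1}Y_{e_1}\boxplus X_{e_2}Y_{e_2}\boxplus\cdots\boxplus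 X_{e_n}Y_{e_n}$. The cocircuits of $M$ are the circuits of its dual: the unique set $\mathcal D\subseteq H^E$ satisfying (C0),(C1) and (C2) with right scalars, whose supports are the cocircuits of the underlying ordinary matroid, and with $X\perp Y$ for all $X\in\mathcal C$, $Y\in\mathcal D$ with $|\underline X\cap\underline Y|\le 3$. A vector of $M$ is $V\in H^E$ with $V\perp Y$ for every cocircuit $Y$; a covector is $U\in H^E$ with $X\perp U$ for every circuit $X$. *)

(* Defs.v *)
(** MathComp, with the sets of MathComp-Analysis ([set T := T -> Prop]) for
    hypersums and for possibly infinite families of vectors. *)
From HB Require Import structures.
From mathcomp Require Import all_boot.
From mathcomp Require Import classical_sets.

Set Implicit Arguments.
Unset Strict Implicit.
Unset Printing Implicit Defensive.

Declare Scope hyper_scope.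
Delimit Scope hyper_scope with H.
Local Open Scope classical_set_scope.

Definition lift_hop (T : Type) (op : T -> T -> set T) (A B : set T) : set T :=
  \bigcup_(a in A) \bigcup_(b in B) op a b.

(** That the nonzero elements are closed under [hmul] and [hinv] follows from
    [hmul0x], [hmulx0], [hmulVx] and [hone_neq0]; the value of [hinv hzero] is
    irrelevant. *)
HB.mixin Record isSkewHyperfield (H : Type) of Equality H := {
  hzero : H;
  hone : H;
  hmul : H -> H -> H;
  hinv : H -> H;
  hopp : H -> H;
  hadd : H -> H -> set H;
  hmulA : associative hmul;
  hmul1x : left_id hone hmul;
  hmulx1 : right_id hone hmul;
  hmul0x : left_zero hzero hmul;
  hmulx0 : right_zero hzero hmul;
  hmulVx : forall x, x != hzero -> hmul (hinv x) x = hone;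
  hmulxV : forall x, x != hzero -> hmul x (hinv x) = hone;
  hone_neq0 : hone != hzero;
  hadd_nonempty : forall x y, hadd x y !=set0;
  haddC : commutative hadd;
  haddA : forall x y z,
    lift_hop hadd (hadd x y) [set z] = lift_hop hadd [set x] (hadd y z);
  haddx0 : forall x, hadd x hzero = [set x];
  hadd_opp : forall x y, hadd x y hzero <-> y = hopp x;
  hadd_rev : forall x y z, hadd y z x <-> hadd (hopp y) x z;
  hmul_addr : forall a x y,
    [set hmul a z | z in hadd x y] = hadd (hmul a x) (hmul a y);
  hmul_addl : forall a x y,
    [set hmul z a | z in hadd x y] = hadd (hmul x a) (hmul y a)
}.

#[short(type="skewHyperfieldType")]
HB.structure Definition SkewHyperfield :=
  {H of Equality H & isSkewHyperfield H}.

Notation "0" := hzero : hyper_scope.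
Notation "1" := hone : hyper_scope.
Notation "- x" := (hopp x) : hyper_scope.
Notation "x * y" := (hmul x y) : hyper_scope.
Notation "x ⊞ y" := (hadd x y) (at level 50, left associativity) : hyper_scope.
Local Open Scope hyper_scope.

Definition stringent (H : skewHyperfieldType) : Prop :=
  forall a b : H, a <> - b -> exists c, a ⊞ b = [set c].

Section Matroids.
Variable E : finType.
Implicit Types (F : set {set E}) (A B K : {set E}).

(** The ordinary matroid whose set of circuits is [F]. *)
Definition indep F A : Prop := ~ exists2 B, F B & B \subset A.

Definition basis F B : Prop :=
  indep F B /\ forall A, indep F A -> B \subset A -> A = B.

(** The bases of the dual matroid are the complements of the bases. *)
Definition coindep F A : Prop := exists2 B, basis F B & A \subset ~: B.

Definition cocircuit F K : Prop :=
  ~ coindep F K /\ forall A, A \proper K -> coindep F A.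

End Matroids.

Section HyperfieldMatroids.
Variables (H : skewHyperfieldType) (E : finType).
Notation vect := {ffun E -> H}.
Implicit Types (X Y Z U V : vect) (C D : set vect).

Definition vzero : vect := [ffun => 0].
Definition lscale (a : H) X : vect := [ffun e => a * X e].
Definition rscale X (a : H) : vect := [ffun e => X e * a].

Definition supp X : {set E} := [set e | X e != 0]%SET.

(** [hadd] is associative and commutative, so the order in which [E] is
    enumerated is irrelevant; the empty hypersum is [[set 0]]. *)
Definition orth X Y : Prop :=
  (\big[lift_hop hadd/[set 0]]_(e : E) [set X e * Y e]) 0.

(** All the pairs here are pairs of distinct supports.  Were [X'] and [Y']
    only required to be distinct vectors, [X] and a proper multiple of [X]
    would be an obstruction; were [X] and [Y] allowed to have the same support,
    elimination applied to [X] and [- X] would contradict [circ_incomp]. *)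
Definition modular_pair C X Y : Prop :=
  supp X <> supp Y /\
  ~ exists X' Y', [/\ C X', C Y', supp X' <> supp Y' &
                      supp X' :|: supp Y' \proper supp X :|: supp Y].

Record left_matroid C : Prop := LeftMatroid {
  circ_neq0 : ~ C vzero;
  circ_scale : forall X a, C X -> a <> 0 -> C (lscale a X);
  circ_incomp : forall X Y, C X -> C Y -> supp X \subset supp Y ->
    exists2 a, a <> 0 & Y = lscale a X;
  circ_elim : forall X Y e, C X -> C Y -> modular_pair C X Y ->
    X e = - Y e -> X e <> 0 ->
    exists Z, [/\ C Z, Z e = 0 & forall f, (X f ⊞ Y f) (Z f)]
}.

(** [D] is the set of circuits of the dual of the left matroid with set of
    circuits [C]. *)
Record dual_circuits C D : Prop := DualCircuits {
  cocirc_neq0 : ~ D vzero;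
  cocirc_scale : forall Y a, D Y -> a <> 0 -> D (rscale Y a);
  cocirc_incomp : forall X Y, D X -> D Y -> supp X \subset supp Y ->
    exists2 a, a <> 0 & Y = rscale X a;
  cocirc_supp : supp @` D = cocircuit (supp @` C);
  cocirc_orth : forall X Y, C X -> D Y -> #|supp X :&: supp Y| <= 3 ->
    orth X Y
}.

(** The vectors of the matroid with set of cocircuits [D], and the covectors of
    the one with set of circuits [C]. *)
Definition is_vector D V : Prop := forall Y, D Y -> orth V Y.
Definition is_covector C U : Prop := forall X, C X -> orth X U.

End HyperfieldMatroids.

(* Main.v *)
(** A stringent hyperfield has an ultrametric absolute value such that a
    hypersum contains [0] iff its terms of maximal absolute value do so in the
    residue hyperfield.  If [1] is not in [1 ⊞ 1], the residue hyperfield is a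
    skew field.  Choosing a basis [B] for which the fundamental circuits are
    bounded after rescaling by [V], one gets [V f] and [- U e] as hypersums of
    the [V e * X e f] and of the [X e f * U f], so that the double sum of the
    [V e * X e f * U f] is both the sum of the [V f * U f] over [B] and minus
    the sum of the others, up to terms of smaller absolute value.

    If [1] is in [1 ⊞ 1], elements of the same absolute value are equal or
    opposite, and a hypersum contains [0] iff two of its maximal terms are
    opposite or all its terms vanish.  Then circuits are orthogonal to all
    cocircuits, by induction on the size of the intersection of the supports.
    A Farkas lemma in the style of Minty's colouring lemma follows by deleting
    and contracting elements; it turns [V] and [U] violating orthogonality into
    a circuit violating orthogonality to [U] or a cocircuit violating
    orthogonality to [V]. *)
Require Import Defs.
From HB Require Import structures.
From mathcomp Require Import boolp classical_sets all_boot.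

Set Implicit Arguments.
Unset Strict Implicit.
Unset Printing Implicit Defensive.
Local Open Scope classical_set_scope.
Local Open Scope hyper_scope.

(** * The absolute value of a stringent hyperfield *)

Section Hyperfield.
Variable H : skewHyperfieldType.
Implicit Types (a b c d m x y z : H) (A B : set H).

Lemma hadd0x x : 0 ⊞ x = [set x].
Proof. by rewrite haddC haddx0. Qed.

Lemma haddxN x : (x ⊞ - x) 0.
Proof. exact/hadd_opp. Qed.

Lemma hopp0 : - 0 = 0 :> H.
Proof. by symmetry; apply/hadd_opp; rewrite haddx0. Qed.

Lemma hoppK : involutive (@hopp H).
Proof. by move=> x; symmetry; apply/hadd_opp; rewrite haddC; exact: haddxN. Qed.

Lemma hopp_eq x y : (- x = y) <-> (x = - y).
Proof. by split=> [<-|->]; rewrite hoppK. Qed.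

Lemma hopp_eq0 x : (- x == 0) = (x == 0).
Proof.
by apply/eqP/eqP => [/hopp_eq ->|->]; rewrite hopp0.
Qed.

Lemma hmul_add a x y z : (x ⊞ y) z -> (a * x ⊞ a * y) (a * z).
Proof. by move=> xyz; rewrite -hmul_addr; exists z. Qed.

Lemma hadd_mul a x y z : (x ⊞ y) z -> (x * a ⊞ y * a) (z * a).
Proof. by move=> xyz; rewrite -hmul_addl; exists z. Qed.

Lemma hmulxN x y : x * - y = - (x * y).
Proof. by apply/hadd_opp; rewrite -(hmulx0 x); exact/hmul_add/haddxN. Qed.

Lemma hmulNx x y : - x * y = - (x * y).
Proof. by apply/hadd_opp; rewrite -(hmul0x y); exact/hadd_mul/haddxN. Qed.

Lemma hmulVK x y : x != 0 -> hinv x * (x * y) = y.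
Proof. by move=> x0; rewrite hmulA hmulVx // hmul1x. Qed.

Lemma hmulKV x y : x != 0 -> x * (hinv x * y) = y.
Proof. by move=> x0; rewrite hmulA hmulxV // hmul1x. Qed.

Lemma hmulxKV x y : y != 0 -> x * hinv y * y = x.
Proof. by move=> y0; rewrite -hmulA hmulVx // hmulx1. Qed.

Lemma hmulxVK x y : y != 0 -> x * y * hinv y = x.
Proof. by move=> y0; rewrite -hmulA hmulxV // hmulx1. Qed.

Lemma hmul_eq0 x y : (x * y == 0) = (x == 0) || (y == 0).
Proof.
apply/eqP/orP => [xy0|[/eqP->|/eqP->]]; rewrite ?hmul0x ?hmulx0 //.
case: (eqVneq x 0) => [|x0]; [by left|right].
by rewrite -(hmulVK y x0) xy0 hmulx0.
Qed.

Lemma hinv_eq0 x : x != 0 -> hinv x != 0.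
Proof.
move=> x0; apply/eqP => xV0; have := hmulVx _ x0.
by rewrite xV0 hmul0x => /esym/eqP; rewrite (negbTE hone_neq0).
Qed.

Lemma hmulxI a : a != 0 -> injective (hmul a).
Proof. by move=> a0 x y /(congr1 (hmul (hinv a))); rewrite !hmulVK. Qed.

Lemma hmulIx a : a != 0 -> injective (fun x => x * a).
Proof. by move=> a0 x y /(congr1 (fun z => z * hinv a)); rewrite !hmulxVK. Qed.

Lemma hadd_oppE x y z : (x ⊞ y) z -> (- x ⊞ - y) (- z).
Proof. by move=> /(hmul_add (hopp 1)); rewrite !hmulNx !hmul1x. Qed.

Lemma haddNxy x y z : (x ⊞ y) z <-> (- x ⊞ z) y.
Proof. exact: hadd_rev. Qed.

Lemma haddAP x y z w : (exists2 u, (x ⊞ y) u & (u ⊞ z) w) <->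
  (exists2 u, (y ⊞ z) u & (x ⊞ u) w).
Proof.
have := haddA x y z; rewrite /lift_hop => e; split.
  move=> [u xyu uzw].
  have : (\bigcup_(a in x ⊞ y) \bigcup_(b in [set z]) (a ⊞ b)) w.
    by exists u => //; exists z.
  by rewrite e => -[_ -> [v yzv xvw]]; exists v.
move=> [u xyu uzw].
have : (\bigcup_(a in [set x]) \bigcup_(b in y ⊞ z) (a ⊞ b)) w.
  by exists x => //; exists u.
by rewrite -e => -[v xyv [_ -> vzw]]; exists v.
Qed.

(** A stringent hyperfield carries an ultrametric absolute value, of which [hlt]
    and [hle] are the strict and the weak comparison; the value group is not
    constructed. *)
Definition hlt x y := [/\ (y ⊞ - y) x, x <> y & x <> - y].
Definition hle x y := ~ hlt y x.

Lemma hltN x y : hlt x (- y) <-> hlt x y.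
Proof. by split=> -[h1 h2 h3]; split=> //; move: h1 h2 h3; rewrite hoppK haddC. Qed.

Lemma hltNl x y : hlt (- x) y <-> hlt x y.
Proof.
suff imp z : hlt z y -> hlt (- z) y by split=> [/imp|/imp//]; rewrite hoppK.
move=> [h1 h2 h3]; split; first by rewrite haddC -{2}(hoppK y); exact: hadd_oppE.
- by move/hopp_eq.
- by move/(can_inj hoppK).
Qed.

Lemma hlt0x x : x != 0 -> hlt 0 x.
Proof.
move=> x0; split; first exact: haddxN.
- by move=> e; rewrite -e eqxx in x0.
- by move/hopp_eq; rewrite hopp0 => e; rewrite -e eqxx in x0.
Qed.

Lemma hltx0 x : ~ hlt x 0.
Proof. by case; rewrite hopp0 haddx0. Qed.

Lemma hle0x x : hle 0 x.
Proof. exact: hltx0. Qed.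

Lemma hlt_mull a x y : a != 0 -> hlt x y -> hlt (a * x) (a * y).
Proof.
move=> a0 [h1 h2 h3]; split.
- by rewrite -hmulxN; exact: hmul_add.
- by move/(hmulxI a0).
- by rewrite -hmulxN => /(hmulxI a0).
Qed.

Lemma hlt_mulr a x y : a != 0 -> hlt x y -> hlt (x * a) (y * a).
Proof.
move=> a0 [h1 h2 h3]; split.
- by rewrite -hmulNx; exact: hadd_mul.
- by move/(hmulIx a0).
- by rewrite -hmulNx => /(hmulIx a0).
Qed.

Lemma hle_mull a x y : hle x y -> hle (a * x) (a * y).
Proof.
case: (eqVneq a 0) => [->|a0 xy]; first by rewrite !hmul0x => _; apply: hltx0.
by move=> /(hlt_mull (hinv_eq0 a0)); rewrite !hmulVK.
Qed.

Lemma hle_mulr a x y : hle x y -> hle (x * a) (y * a).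
Proof.
case: (eqVneq a 0) => [->|a0 xy]; first by rewrite !hmulx0 => _; apply: hltx0.
by move=> /(hlt_mulr (hinv_eq0 a0)); rewrite !hmulxVK.
Qed.

Lemma hltxx x : ~ hlt x x.
Proof. by case. Qed.

Lemma hlexx x : hle x x.
Proof. exact: hltxx. Qed.

Lemma hleNx x y : hle (- x) y <-> hle x y.
Proof. by rewrite /hle; split=> h /hltN. Qed.

Hypothesis sH : stringent H.

Lemma hadd_fun x y z w : x <> - y -> (x ⊞ y) z -> (x ⊞ y) w -> z = w.
Proof. by move=> /sH[c ->] -> ->. Qed.

(** Reversibility turns [y] in [x ⊞ - x] into [x] in [x ⊞ y], and stringency leaves no other element
    there. *)
Lemma hlt_add x y : hlt y x -> x ⊞ y = [set x].
Proof.
move=> [h1 h2 h3]; have xyx : (x ⊞ y) x.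
  by apply/haddNxy; rewrite haddC.
case: (@sH x y) => [|c e]; first by move=> /esym/hopp_eq.
by move: xyx; rewrite e => ->.
Qed.

Lemma hlt_intro x y : y <> x -> y <> - x -> (x ⊞ y) x -> hlt y x.
Proof. by move=> h1 h2 /haddNxy; rewrite haddC => h3; split. Qed.

Lemma hlt_asym x y : hlt x y -> ~ hlt y x.
Proof.
move=> xy yx; have := hlt_add xy; rewrite haddC (hlt_add yx) => e.
by case: xy => _ h _; apply: h; have : [set x]%classic x by []; rewrite e.
Qed.

Lemma hltW x y : hlt x y -> hle x y.
Proof. exact: hlt_asym. Qed.

(** Otherwise [x ⊞ z = {c}] and [y ⊞ z = {d}] with [c <> z] and [d <> y]. As [y] absorbs [x],
    associativity puts [d] in [y ⊞ c]; then [- y ⊞ d] contains both [c] and [z], against stringency.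
    This is what makes [hle] transitive. *)
Lemma hle_lt_split x y z : hlt x y -> hlt x z \/ hlt z y.
Proof.
move=> xy; apply: contrapT => /not_orP[xz zy].
have zNx : z <> x by move=> e; apply: zy; rewrite e.
have zNNx : z <> - x by move=> e; apply: zy; rewrite e; apply/hltNl.
have zNy : z <> y by move=> e; apply: xz; rewrite e.
have zNNy : z <> - y by move=> e; apply: xz; rewrite e; apply/hltN.
have [c ec] := @sH x z (fun e => zNNx ((hopp_eq _ _).1 (esym e))).
have [d ed] := @sH y z (fun e => zNNy ((hopp_eq _ _).1 (esym e))).
have cz : c <> z.
  move=> e; apply: xz; apply: hlt_intro => [/esym//|/esym/hopp_eq//|].
  by rewrite haddC ec e.
have dy : d <> y.
  by move=> e; apply: zy; apply: hlt_intro; rewrite // ed e.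
have [|u xzu yud] := (haddAP y x z d).1; first by exists y; rewrite ?ed ?hlt_add.
move: xzu yud; rewrite ec => -> /haddNxy ycd.
have : (- y ⊞ d) z by apply/haddNxy; rewrite hoppK ed.
by move=> ydz; apply: cz; apply: hadd_fun ycd ydz => /(can_inj hoppK)/esym.
Qed.

Lemma hlt_le_trans y x z : hlt x y -> hle y z -> hlt x z.
Proof. by move=> /(@hle_lt_split x y z)[|zy /(_ zy)]. Qed.

Lemma hle_lt_trans y x z : hle x y -> hlt y z -> hlt x z.
Proof. by move=> xy /(@hle_lt_split y z x)[/xy|]. Qed.

Lemma hle_trans y x z : hle x y -> hle y z -> hle x z.
Proof. by move=> xy yz zx; apply: xy; apply: hle_lt_trans zx. Qed.

Lemma hle_total x y : hle x y \/ hle y x.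
Proof. by case: (pselect (hlt y x)) => [/hltW|]; [right|left]. Qed.

(** The ultrametric inequality: if [z] exceeded [m], it would absorb [- x], so that [y = z]. *)
Lemma hadd_le m x y z : hle x m -> hle y m -> (x ⊞ y) z -> hle z m.
Proof.
move=> xm ym xyz mz; move/haddNxy: xyz; rewrite haddC hlt_add.
  by move=> e; rewrite e in ym.
by apply/hltNl; apply: hle_lt_trans mz.
Qed.

Lemma hadd_lt m x y z : hlt x m -> hlt y m -> (x ⊞ y) z -> hlt z m.
Proof.
move=> xm ym; case: (hle_total x y) => [xy|yx] /hadd_le h.
- exact: hle_lt_trans (h _ xy (@hlexx _)) ym.
- exact: hle_lt_trans (h _ (@hlexx _) yx) xm.
Qed.

Lemma hlex0 x : hle x 0 -> x = 0.
Proof. by case: (eqVneq x 0) => // /hlt0x. Qed.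


End Hyperfield.

Lemma finite_max (I : finType) (R : I -> I -> Prop) (P : pred I) i0 :
  (forall x y, R x y \/ R y x) -> (forall x y z, R x y -> R y z -> R x z) ->
  P i0 -> exists2 t, P t & forall i, P i -> R i t.
Proof.
move=> tot tr Pi0.
suff [t Pt tmax] : exists2 t, P t & forall i, i \in i0 :: enum P -> R i t.
  by exists t => // i Pi; apply: tmax; rewrite inE mem_enum [i \in P]Pi orbT.
have : all P (enum P) by apply/allP => i; rewrite mem_enum.
elim: (enum P) => [_|i s IHs /=].
  by exists i0 => // i; rewrite inE => /eqP->; case: (tot i0 i0).
move=> /andP[Pi /IHs[t Pt tmax]].
case: (tot i t) => it.
  exists t => // k; rewrite !inE => /or3P[ki0|/eqP-> //|ks].
    by apply: tmax; rewrite inE ki0.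
  by apply: tmax; rewrite inE ks orbT.
exists i => // k; rewrite !inE => /or3P[ki0|/eqP->|ks].
- by apply: tr it; apply: tmax; rewrite inE ki0.
- by case: (tot i i).
- by apply: tr it; apply: tmax; rewrite inE ks orbT.
Qed.

(** * Finite hypersums *)

Section Hypersums.
Variable H : skewHyperfieldType.
Implicit Types (a b c d m x y z : H) (A B : set H).

Lemma lift_hopP A B z :
  lift_hop hadd A B z <-> exists x y, [/\ A x, B y & (x ⊞ y) z].
Proof.
split=> [[x Ax [y By xyz]]|[x [y [Ax By xyz]]]]; first by exists x, y.
by exists x => //; exists y.
Qed.

Lemma lift_hop11 x y : lift_hop hadd [set x] [set y] = x ⊞ y.
Proof.
apply/seteqP; split=> z; first by case=> _ -> [_ ->].
by move=> xyz; exists x => //; exists y.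
Qed.

Lemma lift_hopC : commutative (lift_hop (@hadd H)).
Proof.
move=> A B; apply/seteqP; split=> z /lift_hopP[x [y [Ax By xyz]]].
- by apply/lift_hopP; exists y, x; rewrite haddC.
- by apply/lift_hopP; exists y, x; rewrite haddC.
Qed.

Lemma lift_hopA : associative (lift_hop (@hadd H)).
Proof.
move=> A B C; apply/seteqP; split=> w /lift_hopP[x [y []]].
- move=> Ax /lift_hopP[b [c [Bb Cc bcy]]] xyw.
  have [|u xbu ucw] := (haddAP x b c w).2; first by exists y.
  by apply/lift_hopP; exists u, c; split=> //; apply/lift_hopP; exists x, b.
- move=> /lift_hopP[a [b [Aa Bb abx]]] Cy xyw.
  have [|u byu auw] := (haddAP a b y w).1; first by exists x.
  by apply/lift_hopP; exists a, u; split=> //; apply/lift_hopP; exists b, y.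
Qed.

Lemma lift_hop0 : left_id [set 0] (lift_hop (@hadd H)).
Proof.
move=> A; apply/seteqP; split=> z.
- by case=> _ -> [y Ay]; rewrite hadd0x => ->.
- by move=> Az; exists 0 => //; exists z => //; rewrite hadd0x.
Qed.

HB.instance Definition _ := Monoid.isComLaw.Build (set H) [set 0]
  (lift_hop (@hadd H)) lift_hopA lift_hopC lift_hop0.

Local Notation "\hsum_ ( i | P ) F" := (\big[lift_hop hadd/[set 0]]_(i | P) F)
  (at level 41, F at level 41, i, P at level 50).
Local Notation "\hsum_ i F" := (\big[lift_hop hadd/[set 0]]_i F)
  (at level 41, F at level 41, i at level 0).

Lemma hsum_nonempty (I : finType) (P : pred I) (x : I -> H) :
  \hsum_(i | P i) [set x i] !=set0.
Proof.
apply: (big_ind (fun A => A !=set0)) => [|A B [a Aa] [b Bb]|i _].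
- by exists 0.
- have [c abc] := hadd_nonempty a b.
  by exists c; apply/lift_hopP; exists a, b.
- by exists (x i).
Qed.

Lemma hsum_sub (I : finType) (P : pred I) (F G : I -> set H) :
  (forall i, P i -> F i `<=` G i) ->
  \hsum_(i | P i) F i `<=` \hsum_(i | P i) G i.
Proof.
move=> FG; apply: (big_ind2 (fun A B => A `<=` B)) => // A A' B B' AA' BB' z.
move=> /lift_hopP[x [y [/AA' ? /BB' ? ?]]].
by apply/lift_hopP; exists x, y.
Qed.

Lemma hsum_morph (f : H -> H) (I : finType) (P : pred I) (x : I -> H) z :
  f 0 = 0 -> (forall a b c, (a ⊞ b) c -> (f a ⊞ f b) (f c)) ->
  (\hsum_(i | P i) [set x i]) z -> (\hsum_(i | P i) [set f (x i)]) (f z).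
Proof.
move=> f0 fD; move: z.
apply: (big_ind2 (fun A B : set H => forall z, A z -> B (f z))).
- by move=> _ ->.
- move=> A A' B B' AA' BB' z /lift_hopP[a [b [/AA' ? /BB' ? ?]]].
  by apply/lift_hopP; exists (f a), (f b); split=> //; apply: fD.
- by move=> i _ _ ->.
Qed.

Lemma hsum_absorb (I : finType) (x : I -> H) t :
  (forall i, i != t -> x t ⊞ x i = [set x t]) ->
  \hsum_i [set x i] = [set x t].
Proof.
move=> xt; rewrite (bigD1 t) //=.
apply: (big_ind (fun A => lift_hop hadd [set x t] A = [set x t])).
- exact: Monoid.mulm1.
- by move=> A B eA eB; rewrite lift_hopA eA.
- by move=> i it; rewrite lift_hop11 xt.
Qed.

Lemma hsum_all0 (I : finType) (x : I -> H) :
  (forall i, x i = 0) -> (\hsum_i [set x i]) 0.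
Proof. by move=> x0; rewrite big1 // => i _; rewrite x0. Qed.

Hypothesis sH : stringent H.

Lemma hsum_le m (I : finType) (P : pred I) (x : I -> H) z :
  (forall i, P i -> hle (x i) m) -> (\hsum_(i | P i) [set x i]) z -> hle z m.
Proof.
move=> xm; move: z.
apply: (big_ind (fun A : set H => forall z, A z -> hle z m)).
- by move=> _ ->; exact: hle0x.
- move=> A B Am Bm z /lift_hopP[a [b [/Am am /Bm bm]]].
  exact: hadd_le.
- by move=> i /xm im _ ->.
Qed.

Lemma hsum_has_max (I : finType) (x : I -> H) (i0 : I) :
  exists t, forall i, hle (x i) (x t).
Proof.
have [||//|t _ tmax] := @finite_max I (fun i j => hle (x i) (x j)) predT i0.
- by move=> i j; exact: hle_total.
- by move=> i j k; exact: hle_trans.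
- by exists t => i; exact: tmax.
Qed.

(** * Hypersums when [1 ⊞ 1] contains [1] *)

Section Idempotent.
Hypothesis idem : (1 ⊞ 1 : set H) 1.

Lemma haddxx x : (x ⊞ x) x.
Proof. by have := hmul_add x idem; rewrite hmulx1. Qed.

(** Otherwise [x ⊞ y = {c}] with [c] different from both. Since [x] lies in [x ⊞ x], [c] lies in
    [x ⊞ c], so [x] is smaller than [c], and likewise [y]; the ultrametric inequality then makes [c]
    smaller than itself. *)
Lemma heqv_opp x y : hle x y -> hle y x -> x = y \/ x = - y.
Proof.
move=> xy yx; apply: contrapT => /not_orP[nxy nxNy].
have [c ec] := sH nxNy.
have cx : c <> x.
  move=> e; apply: xy; apply: hlt_intro => [/esym//|/esym/hopp_eq//|].
  by rewrite ec e.
have cy : c <> y by move=> e; apply: yx; apply: hlt_intro; rewrite // haddC ec e.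
have key u v : u ⊞ v = [set c] -> u <> - v -> c <> u -> c <> v -> hlt u c.
  move=> uv uNv cu cv.
  have [|w uvw uwc] := (haddAP u u v c).1.
    by exists u; [exact: haddxx|rewrite uv].
  move: uvw; rewrite uv => ew; rewrite ew in uwc.
  apply: hlt_intro => [/esym//|euc|]; last by rewrite haddC.
  (* If [u = - c], then [v] lies in [c ⊞ c]. Either [c = - c], whence [c = u], or [c ⊞ c = {c}],
     whence [c = v]. *)
  have : (c ⊞ c) v by rewrite -{1}(hoppK c) -euc; apply/haddNxy; rewrite hoppK uv.
  have [ecc|ncc] := pselect (c = - c); first by case: cu; rewrite ecc euc.
  by move=> ccv; case: cv; exact: hadd_fun ncc (haddxx c) ccv.
have xc := key x y ec nxNy cx cy.
have yc : hlt y c.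
  by apply: (key y x) => //; [rewrite haddC|move/esym/hopp_eq].
by apply: (@hltxx H c); apply: (hadd_lt sH xc yc); rewrite ec.
Qed.

Lemma hadd_absorb x y : hle x y -> x <> - y -> y ⊞ x = [set y].
Proof.
move=> xy xNy; have [/(hlt_add sH)//|yx] := pselect (hlt x y).
have [exy|//] := heqv_opp xy yx.
have [|c ec] := sH (_ : y <> - x); first by move/esym/hopp_eq.
by have := haddxx y; rewrite -{2}exy ec => ->.
Qed.

Lemma hsum_opp (I : finType) (x : I -> H) t :
  (\hsum_i [set x i]) 0 -> x t != 0 -> (forall i, hle (x i) (x t)) ->
  exists2 s, s != t & x s = - x t.
Proof.
move=> + /eqP xt xmax; apply: contraPP => nex; rewrite (@hsum_absorb _ _ t).
  by move/esym.
move=> i it; apply: hadd_absorb => // e; apply: nex; by exists i.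
Qed.

(** The remaining terms have some sum [c] bounded by [x t], and [x t ⊞ - x t] contains [- c]: by
    definition of [hlt] if [c] is smaller, by idempotence if [c] is [x t] or [- x t]. *)
Lemma hsum_opp0 (I : finType) (x : I -> H) s t :
  s != t -> x s = - x t -> (forall i, hle (x i) (x t)) ->
  (\hsum_i [set x i]) 0.
Proof.
move=> st xst xmax; rewrite (bigD1 t) //= (bigD1 s) //= lift_hopA.
have [c cs] := @hsum_nonempty I (fun i => (i != t) && (i != s)) x.
have cm : hle c (x t) by apply: hsum_le cs.
apply/lift_hopP; exists (- c), c; split=> //; last by rewrite haddC; exact: haddxN.
rewrite lift_hop11 xst.
have [clt|ntc] := pselect (hlt c (x t)).
  by case/hltNl: clt.
have tNt : (x t ⊞ - x t) (x t) by rewrite haddC; apply/(haddNxy (x t)); exact: haddxx.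
have [->|->] := heqv_opp cm ntc; last by rewrite hoppK.
by have := hadd_oppE tNt; rewrite hoppK haddC.
Qed.

End Idempotent.

(** * Hypersums when [1 ⊞ 1] does not contain [1] *)

Section ResidueField.
Hypothesis nidem : ~ (1 ⊞ 1 : set H) 1.

(** Either of [z = x] and [z = - x] would put [x] in [x ⊞ x], and scaling would put [1] in
    [1 ⊞ 1]. *)
Lemma haddxN_lt x z : (x ⊞ - x) z -> x != 0 -> hlt z x.
Proof.
move=> xz x0.
have nx : ~ (x ⊞ x) x.
  by move=> /(hmul_add (hinv x)); rewrite hmulVx.
split=> // e; apply: nx.
- by apply/haddNxy; rewrite haddC; rewrite e in xz.
- by have := hadd_oppE xz; rewrite e !hoppK => /(haddNxy x).
Qed.

(** Addition is single-valued up to elements smaller than [m]: the difference of two values regroups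
    into differences of corresponding summands, and [haddxN_lt] handles a single term. *)
Lemma hsum_diff_lt m (I : finType) (P : pred I) (x : I -> H) a b d : m != 0 ->
  (forall i, P i -> hle (x i) m) -> (\hsum_(i | P i) [set x i]) a ->
  (\hsum_(i | P i) [set x i]) b -> (a ⊞ - b) d -> hlt d m.
Proof.
move=> m0 xm.
suff : forall a b d, (\hsum_(i | P i) [set x i]) a ->
  (\hsum_(i | P i) [set x i]) b -> (a ⊞ - b) d -> hlt d m by apply.
apply: (big_ind (fun A : set H => forall a b d, A a -> A b -> (a ⊞ - b) d -> hlt d m)).
- by move=> _ _ d' -> ->; rewrite hopp0 haddx0 => ->; exact: hlt0x.
- move=> A B Am Bm a' b' d' /lift_hopP[p [q [Ap Bq pqa]]].
  move=> /lift_hopP[r [s [Ar Bs /hadd_oppE rsb]]] abd.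
  have : lift_hop hadd (lift_hop hadd [set p] [set - r])
                       (lift_hop hadd [set q] [set - s]) d'.
    rewrite Monoid.mulmACA /= !lift_hop11; apply/lift_hopP.
    by exists a', (- b').
  rewrite !lift_hop11 => /lift_hopP[u [v [pru qsv]]].
  by apply: hadd_lt => //; [exact: Am pru|exact: Bm qsv].
- move=> i Pi _ _ d' -> ->; have [->|xi0] := eqVneq (x i) 0.
    by rewrite hopp0 haddx0 => ->; exact: hlt0x.
  by move=> /haddxN_lt/(_ xi0) dx; apply: (hlt_le_trans sH dx); exact: xm.
Qed.

(** If [d] lies in [x t ⊞ r], then [r] lies in [- x t ⊞ d = {- x t}], so the other terms can sum to
    [- x t]. *)
Lemma hsum_near0 (I : finType) (x : I -> H) t d :
  (\hsum_i [set x i]) d -> hlt d (x t) -> (\hsum_i [set x i]) 0.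
Proof.
rewrite (bigD1 t) //= => /lift_hopP[_ [r [-> xr /haddNxy + dt]]].
rewrite hlt_add //; last exact/hltN.
by move=> er; apply/lift_hopP; exists (x t), r; split=> //; rewrite er; exact: haddxN.
Qed.

End ResidueField.
End Hypersums.

(** * Bases and fundamental circuits *)

Section Matroid.
Variables (H : skewHyperfieldType) (E : finType).
Variables C D : set {ffun E -> H}.
Hypothesis hC : left_matroid C.
Hypothesis hCD : dual_circuits C D.
Implicit Types (X Y Z P Q : {ffun E -> H}) (A B S : {set E}) (e f g : E).

Local Notation ind := (indep (@supp H E @` C)).
Local Notation bas := (basis (@supp H E @` C)).

Lemma supp_sub0 X A e : supp X \subset A -> e \notin A -> X e = 0.
Proof. by move=> /subsetP XA; apply: contraNeq => Xe; apply: XA; rewrite inE. Qed.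

Lemma supp_lscale X (a : H) : a != 0 -> supp (lscale a X) = supp X.
Proof. by move=> a0; apply/setP => e; rewrite !inE ffunE hmul_eq0 (negbTE a0). Qed.

Lemma circ_lscale X a : C X -> a != 0 -> C (lscale a X).
Proof. by move=> CX /eqP; exact: (circ_scale hC). Qed.

Lemma cocirc_rscale Y a : D Y -> a != 0 -> D (rscale Y a).
Proof. by move=> DY /eqP; exact: cocirc_scale hCD _ _ DY. Qed.

Lemma indP A : ind A <-> forall X, C X -> ~~ (supp X \subset A).
Proof.
split=> [iA X CX|hA [_ [X CX <-] XA]]; last by have := hA X CX; rewrite XA.
by apply/negP => XA; apply: iA; exists (supp X) => //; exists X.
Qed.

Lemma nindP A : ~ ind A <-> exists2 X, C X & supp X \subset A.
Proof.
split=> [/contrapT[_ [X CX <-] XA]|[X CX XA] iA]; first by exists X.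
by have := (indP A).1 iA X CX; rewrite XA.
Qed.

Lemma ind_sub A B : ind A -> B \subset A -> ind B.
Proof.
move=> /indP iA BA; apply/indP => X /iA; apply: contra => XB.
exact: subset_trans XB BA.
Qed.

Lemma ind0 : ind set0.
Proof.
apply/indP => X CX; rewrite subset0; apply/negP => /eqP X0.
apply: (circ_neq0 hC); suff <- : X = vzero H E by [].
by apply/ffunP => e; rewrite ffunE; apply: (@supp_sub0 _ set0); rewrite ?X0 ?inE.
Qed.

(** If [e] were the only common element, the hypersum of the products would reduce to one nonzero
    term. *)
Lemma circ_meet X Y e : C X -> D Y -> X e != 0 -> Y e != 0 ->
  exists2 f, f != e & X f != 0 /\ Y f != 0.
Proof.
move=> CX DY Xe Ye; apply: contrapT => nex.
have XY0 f : f != e -> X f * Y f = 0.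
  move=> fe; apply/eqP; rewrite hmul_eq0; apply/negP => /negP/norP[Xf Yf].
  by apply: nex; exists f.
have sub : supp X :&: supp Y \subset [set e]%SET.
  apply/subsetP => f; rewrite !inE => /andP[Xf Yf].
  by apply: contraT => fe; case: nex; exists f.
have : orth X Y.
  apply: (cocirc_orth hCD) => //; apply: leq_trans (subset_leq_card sub) _.
  by rewrite cards1.
rewrite /orth (@hsum_absorb _ _ (fun e => X e * Y e) e).
  by move=> /esym/eqP; rewrite hmul_eq0 (negbTE Xe) (negbTE Ye).
by move=> f fe /=; rewrite (XY0 f fe) haddx0.
Qed.

Lemma circ_cocirc2 X Y e f : C X -> D Y -> e != f ->
  (forall g, g != e -> g != f -> X g = 0 \/ Y g = 0) ->
  X f * Y f = - (X e * Y e).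
Proof.
move=> CX DY ef XY0; apply/hadd_opp.
have XY00 g : g != e -> g != f -> X g * Y g = 0.
  by move=> ge gf; case: (XY0 _ ge gf) => ->; rewrite ?hmul0x ?hmulx0.
have : orth X Y.
  apply: (cocirc_orth hCD) => //.
  apply: (@leq_trans #|[set e; f]%SET|); last by rewrite cards2; case: (_ != _).
  apply: subset_leq_card; apply/subsetP => g; rewrite !inE => /andP[Xg Yg].
  apply: contraT => /norP[ge gf].
  by case: (XY0 _ ge gf) => e0; move: Xg Yg; rewrite e0 eqxx.
rewrite /orth (bigD1 e) //= (bigD1 f) 1?eq_sym //= big1 ?Monoid.mulm1 ?lift_hop11 //.
by move=> g /andP[ge gf]; rewrite XY00.
Qed.

Lemma max_ind_in S A : ind A -> A \subset S ->
  exists B, [/\ ind B, A \subset B, B \subset S &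
    forall e, e \in S -> e \notin B -> ~ ind (e |: B)].
Proof.
move=> iA AS; pose P := [pred B : {set E} | `[< ind B >] && (B \subset S)].
have [|B /maxsetP[/andP[/asboolP iB BS] maxB] AB] := @maxset_exists _ P A.
  by apply/andP; split=> //; apply/asboolP.
exists B; split=> // e eS eB ieB; move/negP: eB; apply.
rewrite -(maxB (e |: B)) ?setU11 ?subsetUr //=.
by apply/andP; split; [apply/asboolP|rewrite subUset sub1set eS].
Qed.

Lemma basisP B : bas B <-> ind B /\ forall e, e \notin B -> ~ ind (e |: B).
Proof.
split=> -[iB maxB]; split=> //.
  move=> e eB /maxB/(_ (subsetUr _ _)) eBB.
  by move: eB; rewrite -eBB setU11.
move=> A iA BA.
apply/eqP; rewrite eqEsubset BA andbT; apply/subsetP => e eA.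
apply: contraT => eB; case: (maxB e eB); apply: ind_sub iA _.
by rewrite subUset sub1set eA.
Qed.

Lemma basis_exists A : ind A -> exists2 B, bas B & A \subset B.
Proof.
move=> /max_ind_in-/(_ [set: E]%SET (subsetT _))[B [iB AB _ maxB]].
by exists B => //; apply/basisP; split=> // e; apply: maxB.
Qed.

(* A minimal codependent subset of [~: (B :\ f)] does it. *)
Lemma fund_cocirc B f : bas B -> f \in B ->
  exists Y, [/\ D Y, Y f = 1 & forall g, g \in B -> g != f -> Y g = 0].
Proof.
move=> bB fB; pose P := [pred K : {set E} | `[< ~ coindep (@supp H E @` C) K >]].
have [|K /minsetP[/asboolP nK minK] KB] := @minset_exists _ P (~: (B :\ f)).
  apply/asboolP => -[B' [iB' maxB']]; rewrite setCS => B'B.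
  have e : B = B' by apply: maxB'; [case: bB|exact: subset_trans B'B (subsetDl _ _)].
  by move/subsetP: B'B => /(_ f); rewrite -e fB setD11 => /(_ isT).
have : cocircuit (@supp H E @` C) K.
  split=> // A AK; apply: contrapT => nA; have /properP[AK' [k kK kA]] := AK.
  have := minK A (asboolT nA) AK'.
  by move=> eAK; move: kA; rewrite eAK kK.
rewrite -(cocirc_supp hCD) => -[Y DY eYK].
have YB g : g \in B -> g != f -> Y g = 0.
  move=> gB gf; apply: supp_sub0 (_ : g \notin ~: (B :\ f)); first by rewrite eYK.
  by rewrite !inE gf gB.
have Yf : Y f != 0.
  apply/negP => /eqP Yf; apply: nK; exists B => //; rewrite -eYK.
  apply/subsetP => g; rewrite !inE; apply: contra => gB; apply/eqP.
  by have [->|/(YB g gB)] := eqVneq g f.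
exists (rscale Y (hinv (Y f))); split.
- by apply: cocirc_rscale => //; exact: hinv_eq0.
- by rewrite ffunE hmulxV.
- by move=> g gB gf; rewrite ffunE YB // hmul0x.
Qed.

Lemma circ_elt B e X : ind B -> C X -> supp X \subset e |: B -> X e != 0.
Proof.
move=> /indP iB CX XB; apply: contraNneq (iB X CX) => Xe.
apply/subsetP => g gX; have := subsetP XB g gX.
by rewrite !inE => /orP[/eqP eg|//]; move: gX; rewrite inE eg Xe eqxx.
Qed.

Lemma circ_notin B e X : ind B -> C X -> supp X \subset e |: B -> e \notin B.
Proof.
move=> /indP iB CX XB; apply: contra (iB X CX) => eB.
by apply: subset_trans XB _; rewrite subUset sub1set eB subxx.
Qed.

(** Were [Y e] nonzero, [Y] would meet a circuit inside [e |: B] in [e] only. *)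
Lemma cospan0 B S Y : ind B -> (forall e, e \in S -> e \notin B -> ~ ind (e |: B)) ->
  D Y -> (forall e, e \in B -> Y e = 0) -> forall e, e \in S -> Y e = 0.
Proof.
move=> iB spB DY YB e eS; have [/YB//|eB] := boolP (e \in B).
have /nindP[X CX XB] := spB e eS eB; have Xe := circ_elt iB CX XB.
apply/eqP; apply: contraT => Ye.
have [f fe [Xf Yf]] := circ_meet CX DY Xe Ye.
have : f \in e |: B by apply: (subsetP XB); rewrite inE.
by rewrite !inE (negbTE fe) /= => /YB/eqP; rewrite (negbTE Yf).
Qed.

(** The circuit exists if [S] spans [t]. Otherwise [t] and a basis of [S] extend to a basis, whose
    fundamental cocircuit at [t] vanishes on [S] by [cospan0]. This is the base case of [farkas]. *)
Lemma circ_or_cocirc S t : t \notin S ->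
  (exists X, [/\ C X, X t != 0 & supp X \subset t |: S]) \/
  (exists Y, [/\ D Y, Y t != 0 & forall e, e \in S -> Y e = 0]).
Proof.
move=> tS; have [B [iB _ BS maxB]] := max_ind_in ind0 (sub0set S).
have [/nindP[X CX XB]|itB] := pselect (~ ind (t |: B)).
  left; exists X; split=> //; first exact: circ_elt CX XB.
  by apply: subset_trans XB _; exact: setUS.
right; have [B1 bB1 tBB1] := basis_exists (contrapT itB).
move: tBB1; rewrite subUset sub1set => /andP[tB1 /subsetP BB1].
have [Y [DY Yt YB1]] := fund_cocirc bB1 tB1.
exists Y; split=> //; first by rewrite Yt hone_neq0.
apply: (cospan0 iB) => // e eB; apply: YB1; first exact: BB1.
by apply: contraNneq tS => <-; exact: (subsetP BS).
Qed.

Lemma cocirc_mem X Y B e f : ind B -> C X -> supp X \subset e |: B -> D Y ->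
  (forall g, g \in B -> g != f -> Y g = 0) -> X f != 0 -> f \in B -> Y f != 0 ->
  Y e != 0.
Proof.
move=> iB CX XB DY YB Xf fB Yf; have [g gf [Xg Yg]] := circ_meet CX DY Xf Yf.
have : g \in e |: B by apply: (subsetP XB); rewrite inE.
by rewrite !inE => /orP[/eqP<-//|/YB/(_ gf)/eqP]; rewrite (negbTE Yg).
Qed.

(** It suffices to compare supports. If [X f] were nonzero and [X' f] zero, the fundamental
    cocircuit of [f] would meet [X'] in [e] only. *)
Lemma circ_uniq B e X X' : ind B -> C X -> C X' ->
  supp X \subset e |: B -> supp X' \subset e |: B ->
  exists2 a, a <> 0 & X' = lscale a X.
Proof.
move=> iB CX CX' XB X'B; apply: (circ_incomp hC) => //.
apply/subsetP => f; rewrite !inE => Xf; apply/negP => /eqP X'f.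
have Xe := circ_elt iB CX XB; have X'e := circ_elt iB CX' X'B.
have fe : f != e by apply: contraNneq X'e => <-; rewrite X'f.
have fB : f \in B.
  have : f \in e |: B by apply: (subsetP XB); rewrite inE.
  by rewrite !inE (negbTE fe).
have [B1 bB1 /subsetP BB1] := basis_exists iB.
have [Y [DY Yf YB1]] := fund_cocirc bB1 (BB1 f fB).
have YB g : g \in B -> g != f -> Y g = 0 by move=> /BB1; exact: YB1.
have Yf0 : Y f != 0 by rewrite Yf hone_neq0.
have Ye := cocirc_mem iB CX XB DY YB Xf fB Yf0.
have [g ge [X'g Yg]] := circ_meet CX' DY X'e Ye.
have : g \in e |: B by apply: (subsetP X'B); rewrite inE.
rewrite !inE (negbTE ge) /= => gB; have [gf|gf] := eqVneq g f.
  by move: X'g; rewrite gf X'f eqxx.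
by move: Yg; rewrite YB ?eqxx.
Qed.

Lemma ind_exchange B e f X : ind B -> C X -> supp X \subset e |: B ->
  f \in B -> X f != 0 -> ind (e |: B :\ f).
Proof.
move=> iB CX XB fB Xf; apply/indP => W CW; apply/negP => WB.
have [B1 bB1 /subsetP BB1] := basis_exists iB.
have [Y [DY Yf YB1]] := fund_cocirc bB1 (BB1 f fB).
have YB g : g \in B -> g != f -> Y g = 0 by move=> /BB1; exact: YB1.
have Yf0 : Y f != 0 by rewrite Yf hone_neq0.
have Ye := cocirc_mem iB CX XB DY YB Xf fB Yf0.
have We : W e != 0.
  exact: circ_elt (ind_sub iB (subsetDl _ [set f]%SET)) CW WB.
have [g ge [Wg Yg]] := circ_meet CW DY We Ye.
have : g \in e |: B :\ f by apply: (subsetP WB); rewrite inE.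
rewrite !inE (negbTE ge) /= => /andP[gf gB].
by move: Yg; rewrite YB ?eqxx.
Qed.

(** Two circuits inside the union of the supports that both avoid some [w] in it lie in one set
    [g |: A] with [A] independent, so [circ_uniq] makes them proportional. Here [A] is [B] if [w] is
    [e] or [f], and otherwise arises from [B] by exchanging [w] for [e] or [f]. *)
Lemma modular_fund B e f X X' : ind B -> e != f -> C X -> C X' ->
  supp X \subset e |: B -> supp X' \subset f |: B -> modular_pair C X X'.
Proof.
move=> iB ef CX CX' XB X'B.
have Xe := circ_elt iB CX XB; have eB := circ_notin iB CX XB.
have fB := circ_notin iB CX' X'B.
split.
  move=> eXX'; have : e \in supp X by rewrite inE.
  rewrite eXX' => /(subsetP X'B).
  by rewrite !inE (negbTE ef) (negbTE eB).
move=> [P [Q [CP CQ PQ /properP[sub [w wXX' wPQ]]]]]; apply: PQ.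
suff [A [g [iA PA QA]]] : exists A g,
    [/\ ind A, supp P \subset g |: A & supp Q \subset g |: A].
  have [a /eqP a0 ->] := circ_uniq iA CP CQ PA QA.
  by rewrite supp_lscale.
have sub' g : g \in supp P :|: supp Q -> g != w /\ (g \in e |: (f |: B)).
  move=> gPQ; split; first by apply: contraNneq wPQ => <-.
  have := subsetP sub g gPQ; rewrite inE => /orP[].
    by move/(subsetP XB); rewrite !inE => /orP[]->; rewrite ?orbT.
  by move/(subsetP X'B); rewrite !inE orbA => /orP[]->; rewrite ?orbT.
have supP A : (forall g, g \in supp P :|: supp Q -> g \in A) ->
    supp P \subset A /\ supp Q \subset A.
  by move=> h; split; apply/subsetP => g gP; apply: h; rewrite inE gP ?orbT.
have [we|we] := eqVneq w e.
  exists B, f; have [|? ?] := supP (f |: B); last by [].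
  by move=> g /sub'[]; rewrite we => ge; rewrite inE inE (negbTE ge).
have [wf|wf] := eqVneq w f.
  exists B, e; have [|? ?] := supP (e |: B); last by [].
  by move=> g /sub'[]; rewrite wf => gf; rewrite !inE (negbTE gf).
have {wXX'} [wX|wX'] : w \in supp X \/ w \in supp X' by apply/orP; rewrite -in_setU.
- have wB : w \in B.
    by have := subsetP XB w wX; rewrite !inE (negbTE we).
  exists (e |: B :\ w), f; have [|? ?] := supP (f |: (e |: B :\ w)).
    move=> g /sub'[gw]; rewrite !inE gw /= => /or3P[]->; rewrite ?orbT //.
  by split=> //; apply: ind_exchange XB wB _ => //; rewrite inE in wX.
- have wB : w \in B.
    by have := subsetP X'B w wX'; rewrite !inE (negbTE wf).
  exists (f |: B :\ w), e; have [|? ?] := supP (e |: (f |: B :\ w)).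
    move=> g /sub'[gw]; rewrite !inE gw /= => /or3P[]->; rewrite ?orbT //.
  by split=> //; apply: ind_exchange X'B wB _ => //; rewrite inE in wX'.
Qed.

Lemma modular_sub X X' P Q : modular_pair C X X' -> supp P <> supp Q ->
  supp P :|: supp Q \subset supp X :|: supp X' -> modular_pair C P Q.
Proof.
move=> [_ mXX'] nPQ sub; split=> // -[R [S [CR CS RS /proper_sub_trans]]].
by move=> /(_ _ sub) RSsub; apply: mXX'; exists R, S.
Qed.

Lemma circ_sub_elim X X' g : C X -> C X' -> modular_pair C X X' ->
  X g = X' g -> X g != 0 ->
  exists Z, [/\ C Z, Z g = 0 & forall f, (X f ⊞ - X' f) (Z f)].
Proof.
move=> CX CX' mXX' Xg Xg0.
have N1 : hopp 1 != 0 :> H by rewrite hopp_eq0 hone_neq0.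
have N1E f : lscale (hopp 1) X' f = - X' f by rewrite ffunE hmulNx hmul1x.
have [||||Z [CZ Zg Zf]] := @circ_elim _ _ _ hC X (lscale (hopp 1) X') g CX.
- exact: circ_lscale.
- by move: mXX'; rewrite /modular_pair supp_lscale.
- by rewrite N1E hoppK.
- exact/eqP.
by exists Z; split=> // f; have := Zf f; rewrite N1E.
Qed.

(** * Residue skew fields *)

Section OptimalBasis.
Hypothesis sH : stringent H.
Variable V : {ffun E -> H}.

(** [wle f b e a] compares [b] at coordinate [f] with [a] at coordinate [e]
    after rescaling by [V]; a coordinate where [V] vanishes outweighs all
    the others. *)
Definition wle f (b : H) e (a : H) := [\/ V e = 0, b = 0 |
  V f != 0 /\ hle (b * hinv (V f)) (a * hinv (V e))].

(** The middle entry must be nonzero: with [a = 0] the second comparison always holds, and if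
    [V e = 0] so does the first. *)
Lemma wle_trans f b e a g c : a != 0 ->
  wle f b e a -> wle e a g c -> wle f b g c.
Proof.
move=> /eqP a0 fe [Vg|//|[Ve ag]]; first exact: Or31.
case: fe => [Ve0|b0|[Vf ba]]; first by rewrite Ve0 eqxx in Ve.
- exact: Or32.
- by apply: Or33; split=> //; apply: hle_trans ag.
Qed.

Lemma wle_total f b e a : wle f b e a \/ wle e a f b.
Proof.
have [Ve|Ve] := eqVneq (V e) 0; first by left; apply: Or31.
have [Vf|Vf] := eqVneq (V f) 0; first by right; apply: Or31.
by case: (hle_total sH (b * hinv (V f)) (a * hinv (V e))) => h; [left|right]; apply: Or33.
Qed.

Lemma wle_mull f b e a c : wle f b e a -> wle f (c * b) e (c * a).
Proof.
case=> [?|->|[Vf ba]]; [exact: Or31|by apply: Or32; rewrite hmulx0|apply: Or33].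
by split=> //; rewrite -!hmulA; exact: hle_mull.
Qed.

Lemma wleN f b e a : wle f b e a -> wle f (- b) e a.
Proof.
case=> [?|->|[Vf ba]]; [exact: Or31|by apply: Or32; rewrite hopp0|apply: Or33].
by split=> //; rewrite hmulNx; apply/hltN => //; move=> /hltN.
Qed.

Lemma wle_hadd f b b' c e a :
  wle f b e a -> wle f b' e a -> (b ⊞ b') c -> wle f c e a.
Proof.
case=> [?|->|[Vf ba]]; [by move=> *; exact: Or31|by move=> ?; rewrite hadd0x => ->|].
case=> [?|->|[_ ba']]; [by move=> *; exact: Or31| |].
  by rewrite haddx0 => ->; apply: Or33.
by move=> /(hadd_mul (hinv (V f))) bbc; apply: Or33; split=> //; exact: hadd_le bbc.
Qed.

(** Such a [B] is a basis of the restriction to [S] whose fundamental circuits are largest, after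
    rescaling by [V], at their element outside [B]. *)
Definition optimal S B := [/\ ind B, B \subset S & forall e, e \in S -> e \notin B ->
  exists X, [/\ C X, supp X \subset e |: B, X e = 1 & forall f, wle f (X f) e 1]].

(** If [f0] closes a circuit [X0] with [B], let [g] be where [X0] is largest after rescaling. Unless
    [f0] is as large, [g] is exchanged for [f0]; eliminating [g] from the old fundamental circuits
    by means of [X0] gives the new ones, and the ultrametric inequality preserves their bounds. *)
Lemma optimal_insert S B f0 : optimal S B -> exists B', optimal (f0 |: S) B'.
Proof.
move=> [iB BS opt].
have [f0S|f0S] := boolP (f0 \in S).
  exists B; rewrite (setUidPr _) ?sub1set //.
have BfS : f0 |: B \subset f0 |: S by exact: setUS.
have f0B : f0 \notin B by apply: contra f0S; exact: (subsetP BS).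
have inS e : e \in f0 |: S -> e != f0 -> e \in S by rewrite !inE => /orP[->|].
have [ifB|/nindP[X1 CX1 X1B]] := pselect (ind (f0 |: B)).
  exists (f0 |: B); split=> // e /inS eS; rewrite inE negb_or inE => /andP[/eS{}eS eB].
  have [X [CX XB Xe Xw]] := opt e eS eB.
  by exists X; split=> //; apply: subset_trans XB _; rewrite setUCA subsetUr.
have X1f0 := circ_elt iB CX1 X1B.
pose X0 := lscale (hinv (X1 f0)) X1.
have {CX1} CX0 : C X0 by apply: circ_lscale => //; exact: hinv_eq0.
have {X1B} X0B : supp X0 \subset f0 |: B by rewrite supp_lscale // hinv_eq0.
have {X1f0} X0f0 : X0 f0 = 1 by rewrite ffunE hmulVx.
move: X0 CX0 X0B X0f0 => {X1}X0 CX0 X0B X0f0.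
(* Since [wle] is not transitive through zero entries, these are placed below all others. *)
have [|||g X0g gmax] := @finite_max _ (fun f e => X0 f = 0 \/
    X0 e != 0 /\ wle f (X0 f) e (X0 e)) [pred f | X0 f != 0] f0.
- move=> f e; have [->|X0f] := eqVneq (X0 f) 0; first by left; left.
  have [->|X0e] := eqVneq (X0 e) 0; first by right; left.
  by case: (wle_total f (X0 f) e (X0 e)); [left|right]; right.
- move=> f e h [?|[X0e fe]]; first by left.
  case=> [/eqP|[X0h eh]]; first by rewrite (negbTE X0e).
  by right; split=> //; apply: wle_trans eh.
- by rewrite /= X0f0 hone_neq0.
have {}gmax f : wle f (X0 f) g (X0 g).
  have [->|X0f] := eqVneq (X0 f) 0; first exact: Or32.
  by have [/eqP|[_ ]//] := gmax f X0f; rewrite (negbTE X0f).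
have {}X0g : X0 g != 0 by [].
have [gf0|gf0] := pselect (wle g (X0 g) f0 1).
  exists B; split=> // [|e eS eB]; first exact: subset_trans BS (subsetUr _ _).
  have [->|/(inS e eS){}eS] := eqVneq e f0; last exact: opt.
  by exists X0; split=> // f; exact: wle_trans gf0.
have gNf0 : g != f0.
  apply/negP => /eqP e; apply: gf0; rewrite e X0f0.
  by case: (wle_total f0 1 f0 1).
have gB : g \in B.
  have : g \in f0 |: B by apply: (subsetP X0B); rewrite inE.
  by rewrite !inE (negbTE gNf0).
have f0g : wle f0 1 g (X0 g) by rewrite -X0f0.
have iB' : ind (f0 |: B :\ g) by exact: ind_exchange X0B gB X0g.
exists (f0 |: B :\ g); split=> // [|e eS eB'].
  exact: subset_trans (setUS _ (subsetDl _ _)) BfS.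
have [eg|eg] := eqVneq e g.
  exists (lscale (hinv (X0 g)) X0); split.
  - by apply: circ_lscale => //; exact: hinv_eq0.
  - by rewrite supp_lscale ?hinv_eq0 // eg setUCA setD1K.
  - by rewrite eg ffunE hmulVx.
  - move=> f; rewrite eg ffunE -(hmulVx _ X0g); exact: wle_mull.
move: eB'; rewrite !inE eg negb_or /= => /andP[ef0 eB].
have [X [CX XB Xe Xw]] := opt e (inS e eS ef0) eB.
have [Xg|Xg] := eqVneq (X g) 0.
  exists X; split=> //; apply/subsetP => f; rewrite inE => Xf.
  have : f \in e |: B by apply: (subsetP XB); rewrite inE.
  have fg : f != g by apply: contraNneq Xf => ->; rewrite Xg.
  by rewrite !inE fg /= => /orP[]->; rewrite ?orbT.
(* With this factor [lscale a X0] agrees with [X] at [g]. By the choice of [g] its entries are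
   bounded by [X g], hence by [X e = 1]. *)
pose a := X g * hinv (X0 g).
have a0 : a != 0 by rewrite hmul_eq0 negb_or Xg hinv_eq0.
have [|||||Z [CZ Zg Zf]] := @circ_sub_elim X (lscale a X0) g.
- by [].
- exact: circ_lscale.
- apply: (modular_fund iB ef0) => //; first exact: circ_lscale.
  by rewrite supp_lscale.
- by rewrite ffunE hmulxKV.
- exact: Xg.
exists Z; split=> //.
- apply/subsetP => f; rewrite inE => Zf0.
  have fg : f != g by apply: contraNneq Zf0 => ->; rewrite Zg.
  rewrite !inE fg /=; apply: contraT; rewrite !negb_or => /and3P[fe ff0 fB].
  have := Zf f; rewrite ffunE (supp_sub0 XB) ?(supp_sub0 X0B) ?inE ?negb_or ?fe ?ff0 //.
  by rewrite hmulx0 hopp0 haddx0 => e0; rewrite e0 eqxx in Zf0.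
- have := Zf e; rewrite Xe ffunE (supp_sub0 X0B) ?inE ?negb_or ?ef0 //.
  by rewrite hmulx0 hopp0 haddx0.
- move=> f; apply: wle_hadd (Xw f) _ (Zf f); apply: wleN; rewrite ffunE.
  apply: (wle_trans Xg) (Xw g).
  by have := wle_mull a (gmax f); rewrite /a hmulxKV.
Qed.

Lemma optimal_exists S : exists B, optimal S B.
Proof.
rewrite -[S]set_enum; elim: (enum S) => [|e s [B optB]].
  by exists set0; split=> // [|e]; [exact: ind0|rewrite inE].
by rewrite set_cons; exact: optimal_insert optB.
Qed.

Lemma optimal_basis : exists B (X : E -> {ffun E -> H}), bas B /\
  forall e, e \notin B -> [/\ C (X e), supp (X e) \subset e |: B, X e e = 1 &
    forall f, wle f (X e f) e 1].
Proof.
have [B [iB _ opt]] := optimal_exists [set: E]%SET.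
have {}opt e : exists X, e \notin B ->
    [/\ C X, supp X \subset e |: B, X e = 1 & forall f, wle f (X f) e 1].
  have [eB|eB] := boolP (e \in B); first by exists (vzero H E).
  by have [X ?] := opt e (finset.in_setT e) eB; exists X.
have [X hX] := choice opt.
exists B, X; split=> //; apply/basisP; split=> // e /hX[CX XB _ _].
by apply/nindP; exists (X e).
Qed.

Hypothesis nidem : ~ (1 ⊞ 1 : set H) 1.
Variable U : {ffun E -> H}.

(* With [q e f = V e * X e f * U f], both [\sum_(f in B) V f * U f] and
   [- \sum_(e notin B) V e * U e] lie in the hypersum of all the [q e f]. *)
Lemma residue_field_orth : is_vector D V -> is_covector C U -> orth V U.
Proof.
move=> vV cU; have [[e0]|noE] := pselect (inhabited E); last first.
  by apply: hsum_all0 => e; case: noE.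
have [t tmax] := hsum_has_max sH (fun e => V e * U e) e0.
have [m0|m0] := eqVneq (V t * U t) 0.
  by apply: hsum_all0 => e; apply: hlex0; rewrite -m0; exact: tmax.
have [B [X [bB hX]]] := optimal_basis.
pose P e := e \notin B; pose Q f := f \in B; pose q e f := V e * X e f * U f.
(* Optimality bounds [V e * X e f * hinv (V f)] by [1], so that [q e f] is at most [V f * U f]. *)
have qm e f : P e -> hle (q e f) (V t * U t).
  move=> eB; have [CX XB Xe Xw] := hX e eB.
  case: (Xw f) => [Ve|Xf|[Vf le1]].
  - by rewrite /q Ve !hmul0x; exact: hle0x.
  - by rewrite /q Xf hmulx0 hmul0x; exact: hle0x.
  - apply: hle_trans (tmax f) => //.
    have [Ve|Ve] := eqVneq (V e) 0; first by rewrite /q Ve !hmul0x; exact: hle0x.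
    rewrite /q -[X e f](hmulxKV _ Vf) -!hmulA.
    have := hle_mulr (a := V f * U f) (hle_mull (a := V e) le1).
    by rewrite hmul1x hmulxV // hmul1x -!hmulA.
(* The fundamental cocircuit [Y] of [f] has [Y e = - X e f] for [e] outside [B], so [orth V Y]
   expresses [V f] through column [f] of [X]. *)
have colV f : Q f -> (\big[lift_hop hadd/[set 0]]_(e | P e) [set V e * X e f]) (V f).
  move=> fB; have [Y [DY Yf YB]] := fund_cocirc bB fB.
  have XY e : P e -> V e * X e f = - (V e * Y e).
    move=> eB; have [CX XB Xe _] := hX e eB.
    have ef : e != f by apply: contraNneq eB => ->.
    have := circ_cocirc2 CX DY ef _; rewrite Yf hmulx1 Xe hmul1x => ->.
      by rewrite hmulxN.
    move=> g ge gf; have [/YB|gB] := boolP (g \in B); first by move=> ->; [right|].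
    by left; apply: supp_sub0 XB _; rewrite !inE negb_or ge.
  have := vV Y DY; rewrite /orth (bigD1 f) //= => /lift_hopP[_ [r [-> hr]]].
  rewrite Yf hmulx1 => /hadd_opp er; rewrite -[V f]hoppK -er.
  under eq_bigr => e eB do rewrite (XY e eB).
  apply: (hsum_morph (f := @hopp H)) => //; [exact: hopp0|exact: hadd_oppE|].
  move: hr; rewrite (bigID P) /= [X in lift_hop _ _ X]big1 ?Monoid.mulm1.
    move=> hr; rewrite (eq_bigl (fun e => (e != f) && P e)) // => e.
    by rewrite andb_idl // => eB; apply: contraNneq eB => ->.
  by move=> e /andP[ef]; rewrite negbK => eB; rewrite YB // hmulx0.
have rowU e : P e -> (\big[lift_hop hadd/[set 0]]_(f | Q f) [set X e f * U f]) (- U e).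
  move=> eB; have [CX XB Xe _] := hX e eB.
  have := cU _ CX; rewrite /orth (bigD1 e) //= => /lift_hopP[_ [r [-> hr]]].
  rewrite Xe hmul1x => /hadd_opp <-.
  move: hr; rewrite (bigID Q) /= [X in lift_hop _ _ X]big1 ?Monoid.mulm1.
    move=> hr; rewrite (eq_bigl (fun f => (f != e) && Q f)) // => f.
    by rewrite andb_idl // => fB; apply: contraNneq eB => <-.
  move=> f /andP[fe fB]; rewrite (supp_sub0 XB) ?hmul0x //.
  by rewrite !inE negb_or fe.
have [a ha] := hsum_nonempty Q (fun f => V f * U f).
have [b hb] := hsum_nonempty P (fun e => V e * U e).
pose PQ (ef : E * E) := P ef.1 && Q ef.2.
have haq : (\big[lift_hop hadd/[set 0]]_(ef | PQ ef) [set q ef.1 ef.2]) a.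
  rewrite -(pair_big P Q (fun e f => [set q e f])) /= exchange_big /=.
  apply: hsum_sub ha => f fB _ ->.
  apply: (hsum_morph (f := fun x => x * U f)) (colV f fB); first exact: hmul0x.
  by move=> x y z; exact: hadd_mul.
have hbq : (\big[lift_hop hadd/[set 0]]_(ef | PQ ef) [set q ef.1 ef.2]) (- b).
  rewrite -(pair_big P Q (fun e f => [set q e f])) /=.
  have : (\big[lift_hop hadd/[set 0]]_(e | P e) [set - (V e * U e)]) (- b).
    by apply: (hsum_morph (f := @hopp H)) hb; [exact: hopp0|exact: hadd_oppE].
  apply: hsum_sub => e eB _ ->; rewrite -hmulxN.
  under eq_bigr => f _ do rewrite /q -hmulA.
  apply: (hsum_morph (f := hmul (V e))) (rowU e eB); first exact: hmulx0.
  by move=> x y z; exact: hmul_add.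
(* As [a] and [- b] are values of the same hypersum, [d] is smaller than [V t * U t], and
   [hsum_near0] replaces it by [0]. *)
have [d abd] := hadd_nonempty a b.
apply: (hsum_near0 (t := t) sH (d := d)).
  rewrite (bigID Q) /=; apply/lift_hopP; exists a, b; split=> //.
apply: (hsum_diff_lt sH nidem m0 _ haq hbq); last by rewrite hoppK.
by move=> [e f] /andP[eB _]; exact: qm.
Qed.

End OptimalBasis.

(** * Idempotent hyperfields *)

(* In the flat [~: supp Y], the elements of [B] do not span everything: else
   the fundamental cocircuit of some [a] in [supp X] would lie properly in
   [supp Y]. *)
Lemma circ_flat_elt X Y e : C X -> D Y -> X e != 0 -> Y e != 0 ->
  2 < #|supp X :&: supp Y| ->
  exists B X1 j, [/\ ind B, supp X \subset e |: B,
    forall g, g \in B -> Y g != 0 -> X g != 0 &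
    [/\ C X1, supp X1 \subset j |: B, Y j = 0 &
      exists2 g, X1 g != 0 & Y g != 0]].
Proof.
move=> CX DY Xe Ye XY3.
have iA : ind (supp X :\ e).
  apply/indP => W CW; apply/negP => WX.
  have [|a _ XW] := circ_incomp hC CW CX; first exact: subset_trans WX (subsetDl _ _).
  have We : W e = 0 by apply: supp_sub0 WX _; rewrite !inE eqxx.
  by move: Xe; rewrite XW ffunE We hmulx0 eqxx.
have [|B [iB AB BS spB]] := @max_ind_in (supp X :|: ~: supp Y) _ iA.
  exact: subset_trans (subsetDl _ _) (subsetUl _ _).
have XB : supp X \subset e |: B by rewrite -subDset.
have BX g : g \in B -> Y g != 0 -> X g != 0.
  by move=> /(subsetP BS); rewrite !inE => /orP[//|]; rewrite negbK => ->.
exists B; apply: contrapT => nex.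
pose A := [set g in B | Y g == 0]%SET.
have AB' : A \subset B by apply/subsetP => g; rewrite inE => /andP[].
have [a ae [Xa Ya]] : exists2 a, a != e & X a != 0 /\ Y a != 0.
  exact: circ_meet CX DY Xe Ye.
(* A third common element is available by the bound on the intersection; [K] will vanish at [b]
   although [Y] does not. *)
have [b] : exists b, b \in (supp X :&: supp Y) :\ e :\ a.
  apply/set0Pn; rewrite -card_gt0.
  have := cardsD1 a (supp X :&: supp Y :\ e); have := cardsD1 e (supp X :&: supp Y).
  rewrite !inE ae Xa Ya Xe Ye /= => e1 e2; move: XY3.
  by rewrite e1 e2 !add1n !ltnS.
rewrite !inE => /and3P[ba be /andP[Xb Yb]].
have inB f : f != e -> X f != 0 -> f \in B.
  by move=> fe Xf; apply: (subsetP AB); rewrite !inE fe.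
have [B1 bB1 /subsetP BB1] := basis_exists iB.
have [K [DK Ka KB]] := fund_cocirc bB1 (BB1 _ (inB a ae Xa)).
have K0 : forall f, f \in ~: supp Y -> K f = 0.
  apply: (cospan0 (ind_sub iB AB')) DK _ => [j|f].
    rewrite !inE negbK => Yj; rewrite Yj andbT => jB.
    have [|X1 CX1 X1B] := (nindP (j |: B)).1 (spB j _ jB).
      by rewrite !inE Yj orbT.
    apply/nindP; exists X1 => //; apply/subsetP => g; rewrite inE => X1g.
    have : g \in j |: B by apply: (subsetP X1B); rewrite inE.
    rewrite !inE => /orP[->//|->] /=; apply/orP; right; apply: contraT => Yg.
    by case: nex; exists X1, j; split=> //; split=> //; [exact/eqP|exists g].
  rewrite inE => /andP[fB /eqP Yf]; apply: KB; first exact: BB1.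
  by apply: contraNneq Ya => <-; rewrite Yf.
have [|c _ YK] := cocirc_incomp hCD DK DY.
  apply/subsetP => f; rewrite !inE; apply: contraNneq => Yf.
  by rewrite K0 // !inE Yf eqxx.
move: Yb; rewrite YK ffunE KB ?hmul0x ?eqxx //.
by apply: BB1; apply: inB.
Qed.

Section Idempotent.
Hypothesis sH : stringent H.
Hypothesis idem : (1 ⊞ 1 : set H) 1.

Lemma self_opp (x y : H) : x != 0 -> x = - x -> y = - y.
Proof.
move=> x0 /(congr1 (hmul (hinv x))); rewrite hmulxN hmulVx // => e.
by rewrite -[y in LHS]hmul1x e hmulNx hmul1x.
Qed.

(* At a counterexample with smallest intersection, let [X e * Y e] be maximal
   and scale the circuit [X2] of [circ_flat_elt] so that it is bounded by [X] on
   [supp Y] and agrees with [X] somewhere there.  Any [Z] in [X ⊞ - X2] that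
   vanishes at a point of agreement is orthogonal to [Y], hence takes the value
   [- X h] at another such point [h].  The set of these [h] shrinks strictly
   when [Z] is replaced by the elimination at [h], which is absurd. *)
Lemma strong_orth X Y : C X -> D Y -> orth X Y.
Proof.
move: {2}#|_| (leqnn #|supp X :&: supp Y|) => n; elim: n X Y => [|n IHn] X Y XYn CX DY.
  by apply: (cocirc_orth hCD) => //; apply: leq_trans XYn _.
have [XY3|XY3] := leqP #|supp X :&: supp Y| 3; first exact: (cocirc_orth hCD).
apply: contrapT => nXY.
have [e0 _] : exists e0, e0 \in supp X :&: supp Y.
  by apply/set0Pn; rewrite -card_gt0; apply: leq_trans XY3.
have [e emax] := hsum_has_max sH (fun e => X e * Y e) e0.
have m0 : X e * Y e != 0.
  apply: contra_notN nXY => /eqP m0; apply: hsum_all0 => f.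
  by apply: hlex0; rewrite -m0; exact: emax.
have nopp h : h != e -> X h * Y h <> - (X e * Y e).
  by move=> he eN; apply: nXY; exact: (hsum_opp0 sH idem he).
have [Xe Ye] : X e != 0 /\ Y e != 0.
  by move: m0; rewrite hmul_eq0 negb_or => /andP[].
have [|B [X1 [j [iB XB BX [CX1 X1B Yj [g0 X1g0 Yg0]]]]]] := circ_flat_elt CX DY Xe Ye.
  exact: leq_trans XY3.
have X1X f : X1 f != 0 -> Y f != 0 -> X f != 0.
  move=> X1f Yf; apply: (BX f) => //.
  have : f \in j |: B by apply: (subsetP X1B); rewrite inE.
  by rewrite !inE => /orP[/eqP fj|//]; move: Yf; rewrite fj Yj eqxx.
have {g0 X1g0 Yg0} [X2 [g [CX2 X2B X2X le2 [X2g Xg Yg]]]] : exists X2 g, [/\ C X2,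
    supp X2 \subset j |: B, forall f, X2 f != 0 -> Y f != 0 -> X f != 0,
    forall f, Y f != 0 -> hle (X2 f) (X f) & [/\ X2 g = X g, X g != 0 & Y g != 0]].
  have [|||g /andP[X1g Yg] gmax] := @finite_max _
    (fun f h => hle (X1 f * hinv (X f)) (X1 h * hinv (X h)))
    [pred f | (X1 f != 0) && (Y f != 0)] g0.
  - by move=> *; exact: hle_total.
  - by move=> *; apply: hle_trans; eassumption.
  - by rewrite /= X1g0.
  (* The ratio [X1 f * hinv (X f)] is largest at [g]; left multiplication by [a] makes it [1] there,
     which bounds the scaled circuit by [X] on [supp Y]. *)
  have Xg := X1X g X1g Yg; pose a := X g * hinv (X1 g).
  have a0 : a != 0 by rewrite hmul_eq0 negb_or Xg hinv_eq0.
  exists (lscale a X1), g; split.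
  - exact: circ_lscale.
  - by rewrite supp_lscale.
  - by move=> f; rewrite ffunE hmul_eq0 negb_or => /andP[_]; exact: X1X.
  - move=> f Yf; rewrite ffunE; have [->|X1f] := eqVneq (X1 f) 0.
      by rewrite hmulx0; exact: hle0x.
    have Xf := X1X f X1f Yf.
    have {}gmax : hle (X1 f * hinv (X f)) (X1 g * hinv (X g)).
      by apply: gmax; rewrite /= X1f.
    have := hle_mulr (a := X f) (hle_mull (a := a) gmax).
    by rewrite /a -!hmulA hmulVx // hmulx1 hmulVK // hmulKV.
  - by rewrite ffunE hmulxKV.
have jB := circ_notin iB CX2 X2B; have eB := circ_notin iB CX XB.
have X2j := circ_elt iB CX2 X2B.
have ej : e != j by apply: contraNneq Ye => ->; rewrite Yj.
have Xj : X j = 0 by apply: supp_sub0 XB _; rewrite !inE negb_or eq_sym ej.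
have X2e : X2 e = 0 by apply: supp_sub0 X2B _; rewrite !inE negb_or ej.
have mXX2 : modular_pair C X X2 by exact: modular_fund iB ej CX CX2 XB X2B.
(* The zero at a common element of [X] and [Y] makes the intersection of [supp Z] with [supp Y]
   smaller, so that the induction hypothesis applies to [Z]. *)
pose cand Z := [/\ C Z, exists g, [/\ Z g = 0, X g != 0 & Y g != 0] &
  forall f, (X f ⊞ - X2 f) (Z f)].
pose Q k := [&& X2 k == X k, X k != 0 & Y k != 0].
pose N Z := [set k | Q k && (Z k == - X k)]%SET.
have cand0 Z f : cand Z -> X f = 0 -> X2 f = 0 -> Z f = 0.
  by move=> [_ _ Zf] Xf X2f; have := Zf f; rewrite Xf X2f hopp0 haddx0.
have candle Z f : cand Z -> Y f != 0 -> hle (Z f) (X f).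
  move=> [_ _ Zf] Yf; apply: (hadd_le sH (@hlexx _ _) _ (Zf f)).
  by apply/hleNx; apply: le2.
have mk h : Q h -> exists2 Z, cand Z & Z h = 0.
  move=> /and3P[/eqP X2h Xh Yh].
  have [||Z [CZ Zh Zf]] := @circ_sub_elim X X2 h CX CX2 mXX2 => //.
  by exists Z => //; split=> //; exists h.
have step Z : cand Z -> exists2 Z', cand Z' & #|N Z'| < #|N Z|.
  move=> cZ; have [CZ [k [Zk Xk Yk]] Zf] := cZ.
  have oZY : orth Z Y.
    apply: IHn => //; rewrite -ltnS; apply: leq_trans XYn; apply: proper_card.
    apply/properP; split; last by exists k; rewrite !inE ?Zk ?eqxx ?Xk.
    apply/subsetP => f; rewrite !inE => /andP[Zf0 Yf]; rewrite Yf andbT.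
    apply: contraNneq Zf0 => Xf; rewrite cand0 //.
    apply/eqP; apply: contraT => X2f.
    by have := X2X f X2f Yf; rewrite Xf eqxx.
  have Ze : Z e = X e.
    by have := Zf e; rewrite X2e hopp0 haddx0.
  have Zmax f : hle (Z f * Y f) (Z e * Y e).
    rewrite Ze; have [->|Yf] := eqVneq (Y f) 0; first by rewrite hmulx0; exact: hle0x.
    by apply: (hle_trans sH _ (emax f)); apply: hle_mulr; exact: candle.
  (* The term at [e] is still maximal for [Z], so orthogonality to [Y] yields an opposite term at
     some [h]; [X] has none there, which forces [Z h = - X h]. *)
  have [|h he Zh] := hsum_opp sH idem oZY (t := e) _ Zmax; first by rewrite Ze.
  rewrite Ze in Zh.
  have Yh : Y h != 0.
    by apply: contra_neq m0 => Yh; rewrite -[LHS]hoppK -Zh Yh hmulx0 hopp0.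
  have pe : X h * Y h = X e * Y e.
    have : hle (X e * Y e) (X h * Y h).
      by apply/hleNx; rewrite -Zh; apply: hle_mulr; exact: candle.
    by move=> /(heqv_opp sH idem (emax h))[//|/(nopp h he)].
  have XhN : X h <> - X h.
    by move=> eN; apply: (nopp h he); rewrite {1}eN hmulNx pe.
  have {}Zh : Z h = - X h.
    by apply: (hmulIx Yh); rewrite Zh hmulNx pe.
  have Xh : X h != 0 by apply/negP => /eqP Xh; apply: XhN; rewrite Xh hopp0.
  (* If they differed, [X h] would absorb [- X2 h], and [Z h] would be [X h]. *)
  have X2h : X2 h = X h.
    apply: contrapT => ne; apply: XhN; rewrite -Zh; have := Zf h.
    rewrite (hadd_absorb sH idem) //; first by apply/hleNx; exact: le2.
    by move/(can_inj (@hoppK H)).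
  have [|Z' cZ' Z'h] := mk h; first by rewrite /Q X2h eqxx Xh.
  exists Z' => //; apply: proper_card; apply/properP; split; last first.
    exists h; first by rewrite inE /Q X2h Zh Xh Yh !eqxx.
    by rewrite inE Z'h eq_sym hopp_eq0 (negbTE Xh) andbF.
  have [CZ' _ Z'f] := cZ'.
  have mZZ' : modular_pair C Z Z'.
    apply: modular_sub mXX2 _ _.
      move=> /setP/(_ h); rewrite !inE Zh Z'h eqxx hopp_eq0.
      by rewrite Xh.
    apply/subsetP => f; rewrite !inE; apply: contraTT; rewrite !negb_or !negbK.
    by move=> /andP[/eqP Xf /eqP X2f]; rewrite (cand0 Z) // (cand0 Z') // eqxx.
  (* Both [Z] and [Z'] take the value [- X2 j] at [j]. Eliminating [j] leaves a circuit inside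
     [e |: B], thus a multiple of [X]; its value at [h] shows that it is [- X]. *)
  have [||W [CW Wj Wf]] := circ_sub_elim (g := j) CZ CZ' mZZ'.
  - by have := Zf j; have := Z'f j; rewrite Xj hadd0x => -> ->.
  - by have := Zf j; rewrite Xj hadd0x => ->; rewrite hopp_eq0.
  have WB : supp W \subset e |: B.
    apply/subsetP => f; rewrite inE => Wf0; apply: contraT => feB.
    have Xf : X f = 0 by exact: supp_sub0 XB feB.
    have [fj|fj] := eqVneq f j; first by move: Wf0; rewrite fj Wj eqxx.
    have X2f : X2 f = 0.
      apply: supp_sub0 X2B _; apply: contra feB.
      by rewrite !inE (negbTE fj) /= => ->; rewrite orbT.
    have := Wf f; rewrite (cand0 Z) // (cand0 Z') // hopp0 haddx0 => Wf00.
    by rewrite Wf00 eqxx in Wf0.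
  have [a _ WX] := circ_uniq iB CX CW XB WB.
  have WN f : W f = - X f.
    suff aN1 : a = hopp 1 by rewrite WX ffunE aN1 hmulNx hmul1x.
    apply: (hmulIx Xh); rewrite hmulNx hmul1x.
    by have := Wf h; rewrite Zh Z'h hopp0 haddx0 => <-; rewrite WX ffunE.
  (* Now [- X l] lies in [Z l ⊞ X l]; if [Z l] were not [- X l], then [X l] would absorb it and
     [X l = - X l]. *)
  apply/subsetP => l; rewrite !inE => /andP[Ql /eqP Z'l].
  rewrite Ql /=; apply/eqP; apply: contrapT => Zl.
  have [_ Xl Yl] := and3P Ql.
  have := Wf l; rewrite Z'l hoppK WN haddC (hadd_absorb sH idem) //.
    move=> /esym XlN; apply: XhN; exact: self_opp XlN.
  exact: candle.
have [Z0 cZ0 _] : exists2 Z, cand Z & Z g = 0.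
  by apply: mk; rewrite /Q X2g eqxx Xg.
have : forall k Z, cand Z -> #|N Z| <= k -> False.
  elim=> [|k IHk] Z /step[Z' cZ' lt] le.
    by move: (leq_trans lt le).
  by apply: (IHk Z' cZ'); rewrite -ltnS; exact: leq_trans lt le.
by move=> /(_ _ _ cZ0 (leqnn _)).
Qed.

Lemma orth_dominated X Y f : orth X Y ->
  (forall g, g != f -> hlt (X g * Y g) (X f * Y f)) -> X f * Y f = 0.
Proof.
rewrite /orth => oXY dom; move: oXY.
rewrite (@hsum_absorb _ _ (fun e => X e * Y e) f) => [/esym//|g gf].
by rewrite hlt_add //; exact: dom.
Qed.

(** * A Farkas lemma for circuits and cocircuits *)

Section Farkas.
Variable v : E -> H.

(** The elements of [A] are contracted, those outside [A] and [F] are deleted.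
    If [1 = - 1], a circuit may take the value [- v f]; a cocircuit may never
    take the corresponding value. *)
Definition circ_fits t A (F : {set E}) X := [/\ C X, X t = v t,
  forall e, e \notin A -> e \notin F -> X e = 0 &
  forall f, f \in F -> f != t -> hle (X f) (v f) /\ (X f = - v f -> 1 = hopp 1 :> H)].

Definition cocirc_fits t A (F : {set E}) Y := [/\ D Y, v t * Y t = 1,
  forall e, e \in A -> Y e = 0 &
  forall f, f \in F -> f != t -> hle (v f * Y f) 1 /\ v f * Y f <> hopp 1].

(** Induction on [F], contracting or deleting an element [f] other than [t]. The only obstacle is a
    circuit of the contraction together with a cocircuit of the deletion, both failing at [f]; such
    a pair contradicts [strong_orth]. *)
Lemma farkas t A (F : {set E}) : t \in F ->
  (forall f, f \in F -> f \notin A) -> (forall f, f \in F -> v f != 0) ->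
  (exists X, circ_fits t A F X) \/ (exists Y, cocirc_fits t A F Y).
Proof.
move: {2}#|_| (erefl #|F :\ t|) => n; elim: n A F => [|n IHn] A F Fn tF AF v0;
  have tA := AF t tF.
  have {Fn} F0 f : f \in F -> f != t -> False.
    move=> fF ft; have : f \in F :\ t by rewrite !inE ft.
    by rewrite (cards0_eq Fn) inE.
  have [[X [CX Xt XA]]|[Y [DY Yt YA]]] := circ_or_cocirc tA; [left|right].
    have a0 : v t * hinv (X t) != 0 by rewrite hmul_eq0 negb_or v0 // hinv_eq0.
    exists (lscale (v t * hinv (X t)) X); split=> [||e eA eF|f /F0//].
    - exact: circ_lscale.
    - by rewrite ffunE hmulxKV.
    - rewrite ffunE (supp_sub0 (e := e) XA) ?hmulx0 // !inE negb_or eA andbT.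
      by apply: contraNneq eF => ->.
  have vY0 : v t * Y t != 0 by rewrite hmul_eq0 negb_or v0.
  exists (rscale Y (hinv (v t * Y t))); split=> [||e eA|f /F0//].
  - by apply: cocirc_rscale => //; exact: hinv_eq0.
  - by rewrite ffunE hmulA hmulxV.
  - by rewrite ffunE YA // hmul0x.
have [f] : exists f, f \in F :\ t by apply/set0Pn; rewrite -card_gt0 Fn.
rewrite !inE => /andP[ft fF].
have vf0 := v0 f fF.
have F'n : #|F :\ f :\ t| = n.
  have := cardsD1 f (F :\ t); rewrite Fn !inE ft fF => -[->].
  by congr #|pred_of_set _| => //; apply/setP => g; rewrite !inE andbCA.
have tF' : t \in F :\ f by rewrite !inE eq_sym ft.
have v0' g : g \in F :\ f -> v g != 0 by rewrite inE => /andP[_ /v0].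
have fA := AF f fF.
(* In [IH1] the element [f] is contracted, in [IH2] it is deleted. *)
have IH1 : (exists X, circ_fits t (f |: A) (F :\ f) X) \/
           (exists Y, cocirc_fits t (f |: A) (F :\ f) Y).
  by apply: IHn => // g; rewrite !inE negb_or => /andP[-> /AF].
have IH2 : (exists X, circ_fits t A (F :\ f) X) \/
           (exists Y, cocirc_fits t A (F :\ f) Y).
  by apply: IHn => // g; rewrite !inE => /andP[_ /AF].
have notF' g : g \in F -> g != f -> g \in F :\ f by rewrite !inE => -> ->.
have upX X : circ_fits t (f |: A) (F :\ f) X ->
    hle (X f) (v f) -> (X f = - v f -> 1 = hopp 1 :> H) -> circ_fits t A F X.
  move=> [CX Xt XA XF] Xf1 Xf2; split=> // [e eA eF|g gF gt].
    have ef : e != f by apply: contraNneq eF => ->.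
    by apply: XA; rewrite !inE (negbTE ef).
  by have [->//|gf] := eqVneq g f; apply: XF => //; exact: notF'.
have upX' X : circ_fits t A (F :\ f) X -> circ_fits t A F X.
  move=> [CX Xt XA XF]; split=> // [e eA eF|g gF gt].
    by apply: XA => //; rewrite !inE negb_and eF orbT.
  have [->|gf] := eqVneq g f; last by apply: XF => //; exact: notF'.
  rewrite XA // ?inE ?eqxx //; split; first exact: hle0x.
  by move=> /esym/eqP; rewrite hopp_eq0 (negbTE vf0).
have upY Y : cocirc_fits t A (F :\ f) Y ->
    hle (v f * Y f) 1 -> v f * Y f <> hopp 1 -> cocirc_fits t A F Y.
  move=> [DY Yt YA YF] Yf1 Yf2; split=> // g gF gt.
  by have [->//|gf] := eqVneq g f; apply: YF => //; exact: notF'.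
have upY' Y : cocirc_fits t (f |: A) (F :\ f) Y -> cocirc_fits t A F Y.
  move=> [DY Yt YA YF]; split=> // [e eA|g gF gt].
    by apply: YA; rewrite inE eA orbT.
  have [->|gf] := eqVneq g f; last by apply: YF => //; exact: notF'.
  rewrite YA ?setU11 // hmulx0; split; first exact: hle0x.
  by move=> /esym/eqP; rewrite hopp_eq0 (negbTE (@hone_neq0 H)).
(* Orthogonality to such a [Y0] forces [X f] below [v f], since otherwise the term at [f] would
   strictly dominate. The case of [X0] further down is dual. *)
have [[Y0 [DY0 Y0A Y0f Y0F]]|noY0] := pselect (exists Y, [/\ D Y,
    forall e, e \in A -> Y e = 0, Y f != 0 &
    forall g, g \in F -> g != f -> hlt (v g * Y g) (v f * Y f)]).
  have [[X fX]|[Y /upY'?]] := IH1; [left; exists X|by right; exists Y].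
  have [CX Xt XA XF] := fX.
  have Xf : hlt (X f) (v f).
    apply: contrapT => vXf.
    have le : hle (v f * Y0 f) (X f * Y0 f) by exact: hle_mulr.
    have vY0 : v f * Y0 f != 0 by rewrite hmul_eq0 negb_or vf0.
    suff XY0 : X f * Y0 f = 0 by move: le vY0; rewrite XY0 => /hlex0->; rewrite eqxx.
    apply: orth_dominated (strong_orth CX DY0) _ => g gf.
    have pos : hlt 0 (X f * Y0 f) by exact: hlt_le_trans (hlt0x vY0) le.
    have [gA|gA] := boolP (g \in A); first by rewrite Y0A // hmulx0.
    have [gF|gF] := boolP (g \in F); last first.
      by rewrite XA ?hmul0x // !inE ?negb_or ?gf // negb_and gF orbT.
    apply: hlt_le_trans le => //; apply: hle_lt_trans (Y0F g gF gf) => //.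
    apply: hle_mulr; have [->|gt] := eqVneq g t; first by rewrite Xt; exact: hlexx.
    by apply: (XF g _ gt).1; exact: notF'.
  apply: upX => //; first exact: hltW.
  by move=> eN; move: Xf; rewrite eN => /hltNl /hltxx.
have [[X0 [CX0 X0A X0f X0F]]|noX0] := pselect (exists X, [/\ C X,
    forall e, e \notin A -> e \notin F -> X e = 0, X f != 0 &
    forall g, g \in F -> g != f -> hlt (X g * hinv (v g)) (X f * hinv (v f))]).
  have [[X /upX'?]|[Y fY]] := IH2; [by left; exists X|right; exists Y].
  have [DY Yt YA YF] := fY.
  have Yf : hlt (v f * Y f) 1.
    apply: contrapT => vYf.
    have le : hle (X0 f * hinv (v f)) (X0 f * Y f).
      have := hle_mull (a := X0 f * hinv (v f)) vYf.
      by rewrite hmulx1 -hmulA hmulVK.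
    have vX0 : X0 f * hinv (v f) != 0 by rewrite hmul_eq0 negb_or X0f hinv_eq0.
    suff XY0 : X0 f * Y f = 0 by move: le vX0; rewrite XY0 => /hlex0->; rewrite eqxx.
    apply: orth_dominated (strong_orth CX0 DY) _ => g gf.
    have pos : hlt 0 (X0 f * Y f) by exact: hlt_le_trans (hlt0x vX0) le.
    have [gA|gA] := boolP (g \in A); first by rewrite YA // hmulx0.
    have [gF|gF] := boolP (g \in F); last by rewrite X0A ?hmul0x.
    apply: hlt_le_trans le => //; apply: hle_lt_trans (X0F g gF gf) => //.
    rewrite -[X0 g](hmulxKV _ (v0 g gF)) -hmulA hmulxVK ?v0 //.
    rewrite -[X in hle _ X]hmulx1; apply: hle_mull.
    have [->|gt] := eqVneq g t; first by rewrite Yt; exact: hlexx.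
    by apply: (YF g _ gt).1; exact: notF'.
  apply: upY => //; first exact: hltW.
  by move=> eN; move: Yf; rewrite eN => /hltNl /hltxx.
have [[X fX]|[Y /upY'?]] := IH1; last by right; exists Y.
have [[X' /upX'?]|[Y fY]] := IH2; first by left; exists X'.
have [CX Xt XA XF] := fX; have [DY Yt YA YF] := fY.
have Xg1 g : g \in F -> g != f -> hle (X g) (v g).
  move=> gF gf; have [->|gt] := eqVneq g t; first by rewrite Xt; exact: hlexx.
  by apply: (XF g _ gt).1; exact: notF'.
have Yg1 g : g \in F -> g != f -> hle (v g * Y g) 1.
  move=> gF gf; have [->|gt] := eqVneq g t; first by rewrite Yt; exact: hlexx.
  by apply: (YF g _ gt).1; exact: notF'.
have X0 e : e \notin A -> e \notin F -> X e = 0.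
  move=> eA eF; have ef : e != f by apply: contraNneq eF => ->.
  by apply: XA; rewrite !inE (negbTE ef).
(* Otherwise [X] itself is excluded by [noX0]: its other ratios to [v] on [F] are at most [1].
   Likewise for [Y] and [noY0]. *)
have Xf : hle (X f) (v f).
  move=> lt; apply: noX0; exists X; split=> //.
    by apply/negP => /eqP e; move: lt; rewrite e => /hltx0.
  move=> g gF gf; apply: (@hle_lt_trans _ sH 1).
    by rewrite -(hmulxV _ (v0 g gF)); apply: hle_mulr; exact: Xg1.
  by rewrite -(hmulxV _ vf0); apply: hlt_mulr => //; exact: hinv_eq0.
have Yf : hle (v f * Y f) 1.
  move=> lt; apply: noY0; exists Y; split=> //.
    by apply/negP => /eqP e; move: lt; rewrite e hmulx0 => /hltx0.
  by move=> g gF gf; apply: hle_lt_trans lt => //; exact: Yg1.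
have [YfN|YfN] := pselect (v f * Y f = hopp 1); last by right; exists Y; exact: upY.
have [XfN|XfN] := pselect (X f = - v f -> 1 = hopp 1 :> H).
  by left; exists X; exact: upX.
have {XfN} [XfN N1] : X f = - v f /\ 1 <> hopp 1 :> H.
  by split; [apply: contrapT => h; apply: XfN => /h|move=> h; apply: XfN].
(* The maximal term is [1], so orthogonality demands a term [- 1]. At [f] the term is [1]; elsewhere
   [X g * Y g = - 1] forces [v g * Y g = 1] and [X g = - v g], which is allowed only if
   [1 = - 1]. *)
have XYt : X t * Y t = 1 by rewrite Xt.
have XYmax g : hle (X g * Y g) (X t * Y t).
  rewrite XYt; have [gA|gA] := boolP (g \in A).
    by rewrite YA // hmulx0; exact: hle0x.
  have [gF|gF] := boolP (g \in F); last by rewrite X0 // hmul0x; exact: hle0x.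
  have [Xg Yg] : hle (X g) (v g) /\ hle (v g * Y g) 1.
    by have [->//|gf] := eqVneq g f; split; [exact: Xg1|exact: Yg1].
  by apply: hle_trans Yg => //; exact: hle_mulr.
have [|g gt XYg] := hsum_opp sH idem (strong_orth CX DY) (t := t) _ XYmax.
  by rewrite XYt hone_neq0.
rewrite XYt in XYg; have XYg0 : X g * Y g != 0 by rewrite XYg hopp_eq0 hone_neq0.
have gA : g \notin A by apply: contraNN XYg0 => gA; rewrite YA // hmulx0.
have gF : g \in F by apply: contraNT XYg0 => gF; rewrite X0 // hmul0x.
have [gf|gf] := eqVneq g f.
  by case: N1; move: XYg; rewrite gf XfN hmulNx YfN hoppK.
have [Xg Xg'] := XF g (notF' g gF gf) gt; have [Yg Yg'] := YF g (notF' g gF gf) gt.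
have vYg : v g * Y g = 1.
  have : hle 1 (v g * Y g).
    by apply/hleNx; rewrite -XYg; exact: hle_mulr.
  by move=> /(heqv_opp sH idem Yg)[].
case: N1; apply: Xg'; have Yg0 : Y g != 0.
  by apply: contraNneq XYg0 => ->; rewrite hmulx0.
by apply: (hmulIx Yg0); rewrite XYg hmulNx vYg.
Qed.

End Farkas.

(** Apply [farkas] to [V] on its support, with [t] a maximal term of the product with [U]. A fitting
    circuit cannot be orthogonal to [U] unless some [V h * U h] is opposite to the term at [t]; a
    fitting cocircuit cannot be orthogonal to [V]. *)
Lemma idempotent_orth (V U : {ffun E -> H}) :
  is_vector D V -> is_covector C U -> orth V U.
Proof.
move=> vV cU; have [[e0]|noE] := pselect (inhabited E); last first.
  by apply: hsum_all0 => e; case: noE.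
apply: contrapT => nVU.
have [t tmax] := hsum_has_max sH (fun e => V e * U e) e0.
have m0 : V t * U t != 0.
  apply: contra_notN nVU => /eqP m0; apply: hsum_all0 => f.
  by apply: hlex0; rewrite -m0; exact: tmax.
have nopp h : h != t -> V h * U h <> - (V t * U t).
  by move=> ht eN; apply: nVU; exact: (hsum_opp0 sH idem ht).
have [Vt Ut] : V t != 0 /\ U t != 0.
  by move: m0; rewrite hmul_eq0 negb_or => /andP[].
have [|f _|f|[X [CX Xt X0 XF]]|[Y [DY Yt _ YF]]] :=
  @farkas V t set0 [set f | V f != 0]%SET.
- by rewrite inE.
- by rewrite inE.
- by rewrite inE.
- have XUmax f : hle (X f * U f) (X t * U t).
    rewrite Xt; have [Vf|Vf] := eqVneq (V f) 0.
      by rewrite X0 ?inE ?Vf ?eqxx // hmul0x; exact: hle0x.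
    have [->|ft] := eqVneq f t; first by rewrite Xt; exact: hlexx.
    apply: (hle_trans sH _ (tmax f)); apply: hle_mulr.
    by apply: (XF f _ ft).1; rewrite inE.
  have [|f ft] := hsum_opp sH idem (cU X CX) (t := t) _ XUmax; rewrite Xt // => XUf.
  have XUf0 : X f * U f != 0 by rewrite XUf hopp_eq0.
  have Vf : V f != 0.
    by apply: contraNN XUf0 => /eqP Vf; rewrite X0 ?hmul0x // inE ?Vf ?eqxx.
  have [Xf Xf'] : hle (X f) (V f) /\ (X f = - V f -> 1 = hopp 1 :> H).
    by apply: XF => //; rewrite inE.
  have VUf : V f * U f = V t * U t.
    have : hle (V t * U t) (V f * U f).
      by apply/hleNx; rewrite -XUf; exact: hle_mulr.
    by move=> /(heqv_opp sH idem (tmax f))[//|/(nopp f ft)].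
  have Uf : U f != 0 by apply: contraNneq XUf0 => ->; rewrite hmulx0.
  have XfN : X f = - V f by apply: (hmulIx Uf); rewrite XUf hmulNx VUf.
  (* Here [1 = - 1], so the equal terms at [f] and [t] are also opposite. *)
  apply: (nopp f ft); rewrite VUf; apply: self_opp (Xf' XfN); exact: hone_neq0.
- have VYmax f : hle (V f * Y f) (V t * Y t).
    rewrite Yt; have [->|Vf] := eqVneq (V f) 0; first by rewrite hmul0x; exact: hle0x.
    have [->|ft] := eqVneq f t; first by rewrite Yt; exact: hlexx.
    by apply: (YF f _ ft).1; rewrite inE.
  have [|f ft] := hsum_opp sH idem (vV Y DY) (t := t) _ VYmax; rewrite Yt ?hone_neq0 //.
  have [->|Vf] := eqVneq (V f) 0; last by apply: (YF f _ ft).2; rewrite inE.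
  by rewrite hmul0x => /esym/eqP; rewrite hopp_eq0 (negbTE (@hone_neq0 H)).
Qed.

End Idempotent.
End Matroid.

Theorem theorem1 (H : skewHyperfieldType) (E : finType)
    (C D : set {ffun E -> H}) (V U : {ffun E -> H}) :
  stringent H ->
  left_matroid C ->
  dual_circuits C D ->
  is_vector D V ->
  is_covector C U ->
  orth V U.
Proof.
move=> sH hC hCD vV cU; have [idem|nidem] := pselect ((1 ⊞ 1 : set H) 1).
- exact: (idempotent_orth hC hCD).
- exact: (residue_field_orth hC hCD).
Qed.
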